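(* For $E>0$ let \[ \kappa_{\mathrm{U}(1)}(E):=\min_{\varphi\in L^2_{p,\mathrm{even},n}((-\pi,\pi])}\{\langle\varphi|I-\cos Q|\varphi\rangle:\langle\varphi|P^2|\varphi\rangle\le E\}. \] Then \[ \kappa_{\mathrm{U}(1)}(E)=\max_{s>0}\Big(\frac{s\,a_0(2/s)}{4}+1-sE\Big). \] Moreover, in the $\mathrm{U}(1)$ estimation problem of the context, the minimum $\kappa_{\mathrm{U}(1)}(E)$ is attained by an input state $|\phi\rangle\in\ell^2(\mathbb{Z})$ (with $\langle\phi|H|\phi\rangle\le E$) together with the measurement $M_{|\mathcal{I}\rangle\langle\mathcal{I}|}$ if and only if $\mathcal{F}^{-1}[\phi](\theta)=\mathrm{ce}_0(\theta/2,-2/s_E)$, where $s_E=\mathrm{argmax}_{s>0}\big(\frac{s\,a_0(2/s)}{4}+1-sE\big)$.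
   Context: $L^2_p((-\pi,\pi])$ is the space of $2\pi$-periodic square-integrable functions with inner product $\int_{-\pi}^{\pi}\bar\varphi\psi\,\frac{d\theta}{2\pi}$; $L^2_{p,\mathrm{even},n}$ are its even unit vectors; $Q$ is multiplication by $\theta$, $P=-i\,d/d\theta$. For real $q$, $a_0(q)$ is the smallest eigenvalue of the operator $-\frac{d^2}{dx^2}+2q\cos 2x$ on even $\pi$-periodic functions (the smallest $a$ for which Mathieu's equation $y''+(a-2q\cos2x)y=0$ has a nonzero even $\pi$-periodic solution), and $\mathrm{ce}_0(\cdot,q)$ is a corresponding eigenfunction (Mathieu function). $\mathrm{U}(1)$ estimation problem: $\mathrm{U}(1)\cong(-\pi,\pi]$ acts on $\ell^2(\mathbb{Z})$ (basis $|k\rangle$) by $f(\theta)=\sum_ke^{ik\theta}|k\rangle\langle k|$; Hamiltonian $H=\sum_kk^2|k\rangle\langle k|$; risk $R(\theta,\hat\theta)=1-\cos(\hat\theta-\theta)$. For $\phi=\sum\phi(k)|k\rangle$, $\mathcal{F}^{-1}[\phi](\theta)=\sum_ke^{-ik\theta}\phi(k)$. $M_{|\mathcal{I}\rangle\langle\mathcal{I}|}$ is the covariant POVM $M(B)=\int_Bf(\theta)|\mathcal{I}\rangle\langle\mathcal{I}|f(\theta)^\dagger\frac{d\theta}{2\pi}$ with $|\mathcal{I}\rangle=\sum_k|k\rangle$, whose error for input $|\phi\rangle$ is $\int_{-\pi}^{\pi}(1-\cos\hat\theta)|\mathcal{F}^{-1}[\phi](\hat\theta)|^2\frac{d\hat\theta}{2\pi}$.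 *)

(* Defs.v *)
From Stdlib Require Import Reals ZArith.
From Coquelicot Require Import Coquelicot.
Open Scope R_scope.

Definition ex_zsum (f : Z -> R) : Prop :=
  ex_series (fun n : nat => f (Z.of_nat n)) /\
  ex_series (fun n : nat => f (- Z.of_nat (S n))%Z).
Definition zsum (f : Z -> R) : R :=
  Series (fun n : nat => f (Z.of_nat n)) + Series (fun n : nat => f (- Z.of_nat (S n))%Z).
Definition zsumC (f : Z -> C) : C :=
  (zsum (fun k => Re (f k)), zsum (fun k => Im (f k))).

Definition cexpi (x : R) : C := (cos x, sin x).

Definition l2_unit (c : Z -> C) : Prop :=
  ex_zsum (fun k => Cmod (c k) ^ 2) /\ zsum (fun k => Cmod (c k) ^ 2) = 1.

(** <c| K^2 |c> <= E, where K|k> = k|k> (this is <P^2> in the Fourier basis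
    e^{ik theta} of L^2_p, and <H> for H = sum k^2 |k><k| on l^2(Z)). *)
Definition energy_le (c : Z -> C) (E : R) : Prop :=
  ex_zsum (fun k => IZR k ^ 2 * Cmod (c k) ^ 2) /\
  zsum (fun k => IZR k ^ 2 * Cmod (c k) ^ 2) <= E.

Definition fourier_fun (c : Z -> C) (theta : R) : C :=
  zsumC (fun k => Cmult (c k) (cexpi (IZR k * theta))).

Definition Finv (phi : Z -> C) (theta : R) : C :=
  zsumC (fun k => Cmult (phi k) (cexpi (- (IZR k * theta)))).

Definition cosQ_exp (f : R -> C) : R :=
  RInt (fun theta => (1 - cos theta) * Cmod (f theta) ^ 2) (- PI) PI / (2 * PI).

Definition even_coeffs (c : Z -> C) : Prop := forall k, c (- k)%Z = c k.

Definition kappa_set (E : R) (v : R) : Prop :=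
  exists c : Z -> C, l2_unit c /\ even_coeffs c /\ energy_le c E /\
    v = cosQ_exp (fourier_fun c).

Definition kappa (E : R) : R := real (Glb_Rbar (kappa_set E)).

Definition mathieu_sol (a q : R) (y : R -> R) : Prop :=
  exists y' y'' : R -> R, forall x,
    is_derive y x (y' x) /\ is_derive y' x (y'' x) /\
    y'' x + (a - 2 * q * cos (2 * x)) * y x = 0.

(** nonzero even pi-periodic solution: eigenfunction of -d^2/dx^2 + 2q cos 2x
    on even pi-periodic functions with eigenvalue a *)
Definition mathieu_even_eigen (a q : R) (y : R -> R) : Prop :=
  mathieu_sol a q y /\ (forall x, y (- x) = y x) /\ (forall x, y (x + PI) = y x) /\
  exists x, y x <> 0.

Definition a0 (q : R) : R :=
  real (Glb_Rbar (fun a => exists y, mathieu_even_eigen a q y)).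

Definition gfun (E s : R) : R := s * a0 (2 / s) / 4 + 1 - s * E.

(* Main.v *)
Require Import Defs.
From Stdlib Require Import Reals ZArith Lra Lia Psatz Classical.
From Coquelicot Require Import Coquelicot.
Open Scope R_scope.

(** In Fourier coefficients, [1 - cos Q + s P^2] is the Jacobi operator
    [c_k |-> (s k^2 + 1) c_k - (c_{k+1} + c_{k-1}) / 2].  Its positive decaying solution
    [u] with eigenvalue [lambda(s)] is obtained by shooting: [1 - lambda(s)] is the least
    parameter for which the recursion started at [k = 0] stays positive.  Writing a state
    as [c = u * (c / u)] gives the identity
    [<1 - cos Q> + s <P^2> = lambda(s) |c|^2 + 1/2 sum u_k u_{k+1} |c_{k+1}/u_{k+1} - c_k/u_k|^2],
    so [lambda(s)] is the infimum of the form, attained only at multiples of [u].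
    Comparing two values of [s] shows that [lambda] is concave with supergradient the
    energy of the ground state; this energy is continuous in [s], below [E] at [s = 1/E]
    and unbounded as [s -> 0], so it equals [E] for some [s_E], which is then the argmax of
    [lambda(s) - s E], and the identity at [s_E] solves the constrained problem.
    Finally [lambda(s) = s a_0(2/s) / 4 + 1]: the cosine moments of a Mathieu
    eigenfunction satisfy the same recursion and are bounded, which excludes smaller
    eigenvalues, and they determine the eigenfunction. *)

(** * Sums over the integers *)

(** Neither compactness nor spectral theory enters: attainment of the minimum, uniqueness of the
    minimiser and absence of a duality gap are all read off one sum of squares. The price is paid in
    showing that the ground state energy takes the value [E], which needs bounds on [jac_mu] near
    [s = 0] and decay of the ground state uniform in [s]. Finite energy makes Fourier coefficients
    absolutely summable, so the functions involved are continuous, series are integrated term by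
    term, and Riemann integrals suffice. The sign [- 2 / s] is the one for which the lowest
    eigenfunction has positive Fourier coefficients; translation by half a period exchanges [q] and
    [- q] and reconciles it with [a_0(2/s)]. An arbitrary Mathieu eigenfunction is handled through
    its moments rather than through a Fourier expansion, so the moments must be shown to determine
    an even continuous function; the kernels [cos^{2n}] do this. *)

Lemma ex_zsum_ext (f g : Z -> R) : (forall k, f k = g k) -> ex_zsum f -> ex_zsum g.
Proof.
  intros H [H1 H2]; split.
  - apply (ex_series_ext (fun n : nat => f (Z.of_nat n))); [intros; apply H | exact H1].
  - apply (ex_series_ext (fun n : nat => f (- Z.of_nat (S n))%Z)); [intros; apply H | exact H2].
Qed.

Lemma zsum_ext (f g : Z -> R) : (forall k, f k = g k) -> zsum f = zsum g.
Proof. intros H; unfold zsum; f_equal; apply Series_ext; intros; apply H. Qed.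

Lemma ex_zsum_plus (f g : Z -> R) :
  ex_zsum f -> ex_zsum g -> ex_zsum (fun k => f k + g k).
Proof.
  intros [H1 H2] [H3 H4]; split.
  - exact (ex_series_plus _ _ H1 H3).
  - exact (ex_series_plus _ _ H2 H4).
Qed.

Lemma zsum_plus (f g : Z -> R) :
  ex_zsum f -> ex_zsum g -> zsum (fun k => f k + g k) = zsum f + zsum g.
Proof.
  intros [H1 H2] [H3 H4]; unfold zsum.
  rewrite (Series_plus (fun n => f (Z.of_nat n))) by assumption.
  rewrite (Series_plus (fun n => f (- Z.of_nat (S n))%Z)) by assumption.
  ring.
Qed.

Lemma ex_zsum_scal (a : R) (f : Z -> R) : ex_zsum f -> ex_zsum (fun k => a * f k).
Proof.
  intros [H1 H2]; split.
  - exact (ex_series_scal_l a _ H1).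
  - exact (ex_series_scal_l a _ H2).
Qed.

Lemma zsum_scal (a : R) (f : Z -> R) : zsum (fun k => a * f k) = a * zsum f.
Proof.
  unfold zsum.
  rewrite (Series_scal_l a (fun n => f (Z.of_nat n))).
  rewrite (Series_scal_l a (fun n => f (- Z.of_nat (S n))%Z)).
  ring.
Qed.

Lemma ex_zsum_minus (f g : Z -> R) :
  ex_zsum f -> ex_zsum g -> ex_zsum (fun k => f k - g k).
Proof.
  intros Hf Hg.
  apply (ex_zsum_ext (fun k => f k + (-1) * g k)); [intros; ring|].
  apply ex_zsum_plus; [|apply ex_zsum_scal]; assumption.
Qed.

Lemma zsum_minus (f g : Z -> R) :
  ex_zsum f -> ex_zsum g -> zsum (fun k => f k - g k) = zsum f - zsum g.
Proof.
  intros Hf Hg.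
  rewrite (zsum_ext _ (fun k => f k + (-1) * g k)) by (intros; ring).
  rewrite zsum_plus by (try apply ex_zsum_scal; assumption).
  rewrite zsum_scal; ring.
Qed.

Lemma ex_zsum_le (f g : Z -> R) :
  (forall k, Rabs (f k) <= g k) -> ex_zsum g -> ex_zsum f.
Proof.
  intros H [H1 H2]; split.
  - apply (ex_series_le (K := R_AbsRing) (V := R_CompleteNormedModule) _ (fun n : nat => g (Z.of_nat n))); [intros; apply H | exact H1].
  - apply (ex_series_le (K := R_AbsRing) (V := R_CompleteNormedModule) _ (fun n : nat => g (- Z.of_nat (S n))%Z)); [intros; apply H | exact H2].
Qed.

Lemma Series_nonneg_ge_term (a : nat -> R) (n : nat) :
  (forall k, 0 <= a k) -> ex_series a -> a n <= Series a.
Proof.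
  intros Ha Hs.
  assert (H : sum_n a n <= Series a).
  { apply (is_lim_seq_incr_compare (sum_n a)).
    - exact (Series_correct _ Hs).
    - intros k; rewrite sum_Sn; unfold plus; simpl; specialize (Ha (S k)); lra. }
  apply Rle_trans with (2 := H).
  destruct n as [|n].
  - rewrite sum_O; lra.
  - rewrite sum_Sn; unfold plus; simpl.
    assert (0 <= sum_n a n); [|lra].
    clear -Ha; induction n as [|n IH].
    + rewrite sum_O; apply Ha.
    + rewrite sum_Sn; unfold plus; simpl; specialize (Ha (S n)); lra.
Qed.

Lemma zsum_nonneg_ge_term (f : Z -> R) (k : Z) :
  (forall j, 0 <= f j) -> ex_zsum f -> f k <= zsum f.
Proof.
  intros Hf [H1 H2]; unfold zsum.
  assert (G1 := fun n => Series_nonneg_ge_term _ n (fun j => Hf (Z.of_nat j)) H1).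
  assert (G2 := fun n => Series_nonneg_ge_term _ n (fun j => Hf (- Z.of_nat (S j))%Z) H2).
  cbv beta in G1, G2.
  destruct (Z_le_gt_dec 0 k) as [Hk|Hk].
  - specialize (G1 (Z.to_nat k)). rewrite Z2Nat.id in G1 by assumption.
    specialize (G2 O). assert (H := Hf (-1)%Z). change (- Z.of_nat 1)%Z with (-1)%Z in G2. lra.
  - specialize (G2 (Z.to_nat (-k-1))).
    replace (- Z.of_nat (S (Z.to_nat (- k - 1))))%Z with k in G2 by lia.
    specialize (G1 O). assert (H := Hf 0%Z). change (Z.of_nat 0) with 0%Z in G1. lra.
Qed.

Lemma zsum_nonneg (f : Z -> R) : (forall j, 0 <= f j) -> ex_zsum f -> 0 <= zsum f.
Proof.
  intros Hf H; apply Rle_trans with (f 0%Z); [apply Hf|].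
  now apply zsum_nonneg_ge_term.
Qed.

Lemma zsum_nonneg_zero (f : Z -> R) :
  (forall j, 0 <= f j) -> ex_zsum f -> zsum f <= 0 -> forall k, f k = 0.
Proof.
  intros Hf H H0 k; assert (H1 := zsum_nonneg_ge_term f k Hf H); specialize (Hf k); lra.
Qed.

Lemma zsum_le (f g : Z -> R) :
  (forall k, f k <= g k) -> ex_zsum f -> ex_zsum g -> zsum f <= zsum g.
Proof.
  intros H Hf Hg.
  assert (0 <= zsum (fun k => g k - f k)).
  { apply zsum_nonneg; [intros j; specialize (H j); lra|now apply ex_zsum_minus]. }
  rewrite zsum_minus in H0 by assumption; lra.
Qed.

Lemma ex_zsum_shift (f : Z -> R) : ex_zsum f -> ex_zsum (fun k => f (k + 1)%Z).
Proof.
  intros [H1 H2]; split.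
  - apply (ex_series_ext (fun n => f (Z.of_nat (S n)))); [intros; f_equal; lia|].
    now apply (ex_series_incr_1 (fun n => f (Z.of_nat n))).
  - apply ex_series_incr_1.
    apply (ex_series_ext (fun n => f (- Z.of_nat (S n))%Z)); [intros; f_equal; lia|].
    exact H2.
Qed.

(** The term at [0] passes from the nonnegative half-series to the head of the negative one. This
    invariance later replaces summation by parts. *)
Lemma zsum_shift (f : Z -> R) : ex_zsum f -> zsum (fun k => f (k + 1)%Z) = zsum f.
Proof.
  intros Hf; generalize (ex_zsum_shift f Hf); destruct Hf as [H1 H2]; intros [H3 H4].
  unfold zsum.
  rewrite (Series_incr_1 (fun n => f (Z.of_nat n))) by assumption.
  rewrite (Series_incr_1 (fun n => f (- Z.of_nat (S n) + 1)%Z)) by assumption.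
  rewrite (Series_ext (fun n => f (Z.of_nat n + 1)%Z) (fun n => f (Z.of_nat (S n))))
    by (intros; f_equal; lia).
  rewrite (Series_ext (fun n => f (- Z.of_nat (S (S n)) + 1)%Z) (fun n => f (- Z.of_nat (S n))%Z))
    by (intros; f_equal; lia).
  simpl; ring.
Qed.

Lemma ex_zsum_opp (f : Z -> R) : ex_zsum f -> ex_zsum (fun k => f (- k)%Z).
Proof.
  intros [H1 H2]; split.
  - apply ex_series_incr_1. exact H2.
  - apply (ex_series_ext (fun n => f (Z.of_nat (S n)))); [intros; f_equal; lia|].
    now apply (ex_series_incr_1 (fun n => f (Z.of_nat n))).
Qed.

Lemma zsum_opp (f : Z -> R) : ex_zsum f -> zsum (fun k => f (- k)%Z) = zsum f.
Proof.
  intros Hf; generalize (ex_zsum_opp f Hf); destruct Hf as [H1 H2]; intros [H3 H4].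
  unfold zsum.
  rewrite (Series_incr_1 (fun n => f (Z.of_nat n))) by assumption.
  rewrite (Series_incr_1 (fun n => f (- Z.of_nat n)%Z)) by assumption.
  rewrite (Series_ext (fun n => f (- - Z.of_nat (S n))%Z) (fun n => f (Z.of_nat (S n))))
    by (intros; f_equal; lia).
  simpl; ring.
Qed.

Lemma ex_zsum_unshift (f : Z -> R) : ex_zsum f -> ex_zsum (fun k => f (k - 1)%Z).
Proof.
  intros H; apply ex_zsum_opp in H; apply ex_zsum_shift in H; apply ex_zsum_opp in H.
  revert H; apply ex_zsum_ext; intros; f_equal; lia.
Qed.

Lemma zsum_unshift (f : Z -> R) : ex_zsum f -> zsum (fun k => f (k - 1)%Z) = zsum f.
Proof.
  intros H. rewrite <- (zsum_shift (fun k => f (k - 1)%Z)) by now apply ex_zsum_unshift.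
  apply zsum_ext; intros; f_equal; lia.
Qed.

Lemma is_series_single (v : R) (n : nat) :
  is_series (fun j => if Nat.eqb j n then v else 0) v.
Proof.
  induction n as [|n IH].
  - apply is_series_decr_1.
    change (is_series (fun _ : nat => 0) (v + - v)).
    (* The zero series is summed as [0] times a geometric series. *)
    assert (Hv : v + - v = 0 * / (1 - / 2)) by ring; rewrite Hv.
    apply (is_series_ext (fun n => 0 * (/ 2) ^ n)); [intros; apply Rmult_0_l|].
    apply (is_series_scal_l 0 (fun n => (/ 2) ^ n)), is_series_geom.
    rewrite Rabs_pos_eq; lra.
  - apply is_series_decr_1.
    change (is_series (fun j => if Nat.eqb j n then v else 0) (v + - 0)).
    assert (Hv : v + - 0 = v) by ring; rewrite Hv; exact IH.
Qed.

Lemma zsum_single (f : Z -> R) (k : Z) : (forall j, j <> k -> f j = 0) -> zsum f = f k.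
Proof.
  intros H; unfold zsum.
  assert (Z0 : forall g : nat -> R, (forall n, g n = 0) -> Series g = 0).
  { intros g Hg; rewrite (Series_ext g (fun n => 0 * g n)) by (intros n; rewrite (Hg n); ring).
    rewrite Series_scal_l; ring. }
  destruct (Z_le_gt_dec 0 k) as [Hk|Hk].
  - rewrite (Z0 (fun n => f (- Z.of_nat (S n))%Z)) by (intros; apply H; lia).
    rewrite (Series_ext _ (fun j => if Nat.eqb j (Z.to_nat k) then f k else 0)).
    + rewrite (is_series_unique _ _ (is_series_single (f k) _)); ring.
    + intros n; case (Nat.eqb_spec n (Z.to_nat k)); intros Hn.
      * f_equal; lia.
      * apply H; lia.
  - rewrite (Z0 (fun n => f (Z.of_nat n)%Z)) by (intros; apply H; lia).
    rewrite (Series_ext _ (fun j => if Nat.eqb j (Z.to_nat (-k-1)) then f k else 0)).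
    + rewrite (is_series_unique _ _ (is_series_single (f k) _)); ring.
    + intros n; case (Nat.eqb_spec n (Z.to_nat (-k-1))); intros Hn.
      * f_equal; lia.
      * apply H; lia.
Qed.

(** * The Jacobi recursion and its critical parameter *)

(* With [m = 1 - lambda], the even solution of the eigenvalue equation normalised by [1] at [k = 0]. *)
Fixpoint jac (s m : R) (n : nat) : R :=
  match n with
  | O => 1
  | S n' => match n' with
            | O => m
            | S n'' => 2 * (s * INR n' ^ 2 + m) * jac s m n' - jac s m n''
            end
  end.

Lemma jac_SS (s m : R) (n : nat) :
  jac s m (S (S n)) = 2 * (s * INR (S n) ^ 2 + m) * jac s m (S n) - jac s m n.
Proof. reflexivity. Qed.

Lemma jac_0 (s m : R) : jac s m 0 = 1. Proof. reflexivity. Qed.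
Lemma jac_1 (s m : R) : jac s m 1 = m. Proof. reflexivity. Qed.

Lemma nat_ind2 (P : nat -> Prop) :
  P O -> P 1%nat -> (forall n, P n -> P (S n) -> P (S (S n))) -> forall n, P n.
Proof.
  intros H0 H1 HS n; assert (P n /\ P (S n)); [|tauto].
  induction n as [|n [IH1 IH2]]; split; auto.
Qed.

(** Both parameters vary, because the critical value moves with [s] when the ground state is
    followed along [s]. *)
Lemma jac_continuous (f g : R -> R) (x : R) (n : nat) :
  continuous f x -> continuous g x -> continuous (fun t => jac (f t) (g t) n) x.
Proof.
  intros Hf Hg; induction n as [| |n IH1 IH2] using nat_ind2.
  - apply continuous_const.
  - exact Hg.
  - apply (continuous_ext (fun t => minus (mult (mult 2 (plus (mult (f t) (INR (S n) ^ 2)) (g t)))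
      (jac (f t) (g t) (S n))) (jac (f t) (g t) n))); [intros; rewrite jac_SS; reflexivity|].
    apply (continuous_minus (V := R_NormedModule)); [|exact IH1].
    apply (continuous_mult (K := R_AbsRing)); [|exact IH2].
    apply (continuous_mult (K := R_AbsRing)); [apply continuous_const|].
    apply (continuous_plus (V := R_NormedModule)); [|exact Hg].
    apply (continuous_mult (K := R_AbsRing)); [exact Hf|apply continuous_const].
Qed.

Definition jac_pos (s m : R) : Prop := forall n, 0 < jac s m n.

(** Discrete Sturm comparison: the ratio of consecutive terms obeys [r' = 2 (s n^2 + m) - 1 / r],
    which increases with [r], so a ratio above that of the supersolution [w] stays above it. In the
    cross-multiplied form the same induction yields positivity of the next term. *)
Lemma jac_pos_ratio (s m : R) (w : nat -> R) :
  (forall n, 0 < w n) -> w 1%nat <= m * w O ->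
  (forall n, w n + w (S (S n)) <= 2 * (s * INR (S n) ^ 2 + m) * w (S n)) ->
  forall n, 0 < jac s m n /\ w (S n) * jac s m n <= jac s m (S n) * w n.
Proof.
  intros Hw H0 HS n; induction n as [|n [IH1 IH2]].
  - rewrite jac_0, jac_1; lra.
  - assert (P : 0 < jac s m (S n)).
    { assert (0 < jac s m (S n) * w n); [|specialize (Hw n); nra].
      apply Rlt_le_trans with (2 := IH2); apply Rmult_lt_0_compat; [apply Hw|exact IH1]. }
    split; [exact P|].
    rewrite jac_SS.
    specialize (HS n). apply Rmult_le_compat_r with (r := jac s m (S n)) in HS; [|lra].
    nra.
Qed.

Lemma jac_pos_supersolution (s m : R) (w : nat -> R) :
  (forall n, 0 < w n) -> w 1%nat <= m * w O ->
  (forall n, w n + w (S (S n)) <= 2 * (s * INR (S n) ^ 2 + m) * w (S n)) -> jac_pos s m.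
Proof. intros H1 H2 H3 n; now apply (jac_pos_ratio s m w). Qed.

(** For a larger parameter the positive solution [jac s m] is itself a supersolution. *)
Lemma jac_pos_mono (s m m' : R) : m <= m' -> jac_pos s m -> jac_pos s m'.
Proof.
  intros Hm Hp; apply (jac_pos_supersolution _ _ (jac s m)); [exact Hp| |].
  - rewrite jac_0, jac_1; lra.
  - intros n; rewrite jac_SS; specialize (Hp (S n)); nra.
Qed.

Lemma jac_pos_1 (s : R) : 0 <= s -> jac_pos s 1.
Proof.
  intros Hs; apply (jac_pos_supersolution _ _ (fun _ => 1)); [intros; lra|lra|].
  intros n; assert (0 <= s * INR (S n) ^ 2); [|lra].
  apply Rmult_le_pos; [assumption|apply pow2_ge_0].
Qed.

(* The ground state energy of the Jacobi operator is [1 - jac_mu s]. *)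
Definition jac_mu (s : R) : R := real (Glb_Rbar (jac_pos s)).

Lemma jac_pos_gt0 (s m : R) : jac_pos s m -> 0 < m.
Proof. intros H; exact (H 1%nat). Qed.

(** [real] sends infinite bounds to [0]; the member [1] excludes [p_infty] and the lower bound [0]
    excludes [m_infty]. *)
Lemma jac_mu_glb (s : R) : 0 <= s -> is_glb_Rbar (jac_pos s) (jac_mu s).
Proof.
  intros Hs; unfold jac_mu.
  generalize (Glb_Rbar_correct (jac_pos s)).
  destruct (Glb_Rbar (jac_pos s)) as [l| |]; intros [H1 H2]; simpl.
  - split; assumption.
  - exfalso; exact (H1 1 (jac_pos_1 s Hs)).
  - exfalso. apply (H2 (Finite 0)). intros m Hm; simpl; apply jac_pos_gt0 in Hm; lra.
Qed.

Lemma jac_mu_le (s m : R) : 0 <= s -> jac_pos s m -> jac_mu s <= m.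
Proof. intros Hs Hm; exact (proj1 (jac_mu_glb s Hs) m Hm). Qed.

Lemma jac_pos_above_mu (s m : R) : 0 <= s -> jac_mu s < m -> jac_pos s m.
Proof.
  intros Hs Hm n; destruct (Rlt_dec 0 (jac s m n)) as [H|H]; [exact H|exfalso].
  assert (m <= jac_mu s); [|lra].
  apply (proj2 (jac_mu_glb s Hs) (Finite m)).
  intros m' Hm'; simpl; destruct (Rle_dec m m') as [|Hlt]; [assumption|exfalso].
  apply H; apply (jac_pos_mono s m'); [lra|assumption].
Qed.

Lemma jac_cont_nbhd (s m : R) (n : nat) (c : R) :
  c < jac s m n -> exists d : posreal, forall m', Rabs (m' - m) < d -> c < jac s m' n.
Proof.
  intros Hc.
  assert (H := jac_continuous (fun _ => s) (fun t => t) m n (continuous_const _ _) (continuous_id _)).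
  destruct (H (fun y => c < y)) as [d Hd].
  { apply open_gt; exact Hc. }
  exists d; intros m' Hm'; exact (Hd m' Hm').
Qed.

Lemma jac_mu_ge0 (s : R) : 0 <= s -> forall n, 0 <= jac s (jac_mu s) n.
Proof.
  intros Hs n; destruct (Rle_dec 0 (jac s (jac_mu s) n)) as [H|H]; [exact H|exfalso].
  assert (Hc := jac_continuous (fun _ => s) (fun t => t) (jac_mu s) n (continuous_const _ _) (continuous_id _)).
  destruct (Hc (fun y => y < 0)) as [d Hd].
  { apply open_lt; lra. }
  assert (Hd0 := cond_pos d).
  specialize (Hd (jac_mu s + d / 2)).
  assert (B : ball (jac_mu s) d (jac_mu s + d / 2)).
  { change (Rabs (jac_mu s + d / 2 - jac_mu s) < d); rewrite Rabs_pos_eq; lra. }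
  specialize (Hd B); cbv beta in Hd.
  assert (P := jac_pos_above_mu s (jac_mu s + d / 2) Hs ltac:(lra) n); lra.
Qed.

(** The infimum is attained: the limit from above has nonnegative terms, and a first zero would make
    its successor the negative of its positive predecessor. *)
Lemma jac_mu_pos (s : R) : 0 <= s -> jac_pos s (jac_mu s).
Proof.
  intros Hs; set (m := jac_mu s).
  assert (G : forall n, 0 <= jac s m n) by now apply jac_mu_ge0.
  intros n; induction n as [| |n IH1 IH2] using nat_ind2.
  - rewrite jac_0; lra.
  - assert (H := G 2%nat); assert (H1 := G 1%nat); rewrite jac_SS, jac_0, jac_1 in *.
    destruct (Req_dec m 0) as [Z|Z]; [rewrite Z in *; exfalso|]; lra.
  - destruct (Req_dec (jac s m (S (S n))) 0) as [Z|Z].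
    + exfalso; assert (H := G (S (S (S n)))); rewrite jac_SS, Z in H; lra.
    + specialize (G (S (S n))); lra.
Qed.

(** Once [s n^2 >= 1] the recursion coefficient is at least [2], so a positive solution is convex
    from there on and one nondecreasing step is repeated forever. *)
Lemma jac_increasing (s m : R) (n : nat) :
  0 <= s -> 0 <= m -> 1 <= s * INR n ^ 2 -> 0 < jac s m n -> jac s m n <= jac s m (S n) ->
  forall j, (n <= j)%nat -> 0 < jac s m j /\ jac s m j <= jac s m (S j).
Proof.
  intros Hs Hm Hn P0 P1 j Hj; induction Hj as [|j Hj [IH1 IH2]]; [tauto|].
  split; [lra|].
  rewrite jac_SS.
  assert (1 <= s * INR (S j) ^ 2); [|nra].
  apply Rle_trans with (1 := Hn), Rmult_le_compat_l; [assumption|].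
  apply pow_incr; split; [apply pos_INR|apply le_INR; lia].
Qed.

(* If the critical solution increased once past the turning point, it would keep
   increasing, and so would the solutions for slightly smaller [m]. *)
Lemma jac_mu_decr (s : R) (n : nat) :
  0 <= s -> 1 <= s * INR n ^ 2 -> jac s (jac_mu s) (S n) <= jac s (jac_mu s) n.
Proof.
  intros Hs Hn; set (m := jac_mu s).
  destruct (Rle_dec (jac s m (S n)) (jac s m n)) as [H|H]; [exact H|exfalso].
  assert (Hp : jac_pos s m) by now apply jac_mu_pos.
  assert (Hm := jac_pos_gt0 _ _ Hp).
  (* Positivity up to a fixed index is an open condition on the parameter. *)
  assert (D1 : forall k, exists d : posreal, forall m', Rabs (m' - m) < d ->
    forall j, (j <= k)%nat -> 0 < jac s m' j).
  { induction k as [|k [d1 IH]].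
    - exists (mkposreal 1 Rlt_0_1); intros m' _ j Hj; replace j with O by lia; rewrite jac_0; lra.
    - destruct (jac_cont_nbhd s m (S k) 0 (Hp (S k))) as [d2 H2].
      exists (mkposreal (Rmin d1 d2) (Rmin_stable_in_posreal d1 d2)); simpl; intros m' Hm' j Hj.
      assert (A1 := Rmin_l d1 d2); assert (A2 := Rmin_r d1 d2).
      destruct (Nat.eq_dec j (S k)) as [->|Hne].
      + apply H2; lra.
      + apply (IH m'); [lra|lia]. }
  destruct (D1 n) as [d1 H1].
  (* The midpoint keeps the terms at [n] and [n + 1] in strict order for nearby parameters. *)
  set (c := (jac s m n + jac s m (S n)) / 2).
  destruct (jac_cont_nbhd s m (S n) c ltac:(unfold c; lra)) as [d2 H2].
  assert (Hc := jac_continuous (fun _ => s) (fun t => t) m n (continuous_const _ _) (continuous_id _)).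
  destruct (Hc (fun y => y < c)) as [d3 H3].
  { apply open_lt; unfold c; lra. }
  assert (C1 := cond_pos d1); assert (C2 := cond_pos d2); assert (C3 := cond_pos d3).
  (* The entry [m] keeps the lowered parameter [m - d / 2] nonnegative, as [jac_increasing]
     requires. *)
  set (d := Rmin (Rmin d1 d2) (Rmin d3 m)).
  assert (Hd : 0 < d) by (unfold d; repeat apply Rmin_glb_lt; assumption).
  assert (L1 : d <= d1) by (unfold d; eapply Rle_trans; [apply Rmin_l|apply Rmin_l]).
  assert (L2 : d <= d2) by (unfold d; eapply Rle_trans; [apply Rmin_l|apply Rmin_r]).
  assert (L3 : d <= d3) by (unfold d; eapply Rle_trans; [apply Rmin_r|apply Rmin_l]).
  assert (L4 : d <= m) by (unfold d; eapply Rle_trans; [apply Rmin_r|apply Rmin_r]).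
  set (m' := m - d / 2).
  assert (A : Rabs (m' - m) = d / 2) by (unfold m'; rewrite Rabs_left; lra).
  assert (Q : jac_pos s m').
  { intros j; destruct (Nat.le_gt_cases j n) as [Hj|Hj].
    - apply (H1 m'); [lra|assumption].
    - apply (jac_increasing s m' n); try assumption; try lia.
      + unfold m'; lra.
      + apply (H1 m'); [lra|lia].
      + apply Rlt_le, Rlt_trans with c.
        * apply (H3 m'); change (Rabs (m' - m) < d3); lra.
        * apply (H2 m'); lra. }
  apply jac_mu_le in Q; [|assumption]. fold m in Q. unfold m' in Q; lra.
Qed.

(** The step after [n + 1] also goes down. Inserting the recursion there bounds
    [2 s (n + 1)^2 + 2 jac_mu s - 1] times the term at [n + 1] by the term at [n], and
    [s (n + 1)^2 >= 1]. *)
Lemma jac_mu_decay (s : R) (n : nat) :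
  0 < s -> 1 <= s * INR n ^ 2 ->
  jac s (jac_mu s) (S n) * (s * INR (S n) ^ 2) <= jac s (jac_mu s) n.
Proof.
  intros Hs Hn.
  assert (Hp : jac_pos s (jac_mu s)) by (apply jac_mu_pos; lra).
  assert (Hm := jac_pos_gt0 _ _ Hp).
  assert (M : INR n <= INR (S n)) by (apply le_INR; lia).
  assert (N0 := pos_INR n).
  assert (H1 := jac_mu_decr s n ltac:(lra) Hn).
  assert (H2 : jac s (jac_mu s) (S (S n)) <= jac s (jac_mu s) (S n)).
  { apply jac_mu_decr; [lra|].
    apply Rle_trans with (1 := Hn), Rmult_le_compat_l; [lra|]. apply pow_incr; lra. }
  rewrite jac_SS in H2.
  assert (P := Hp (S n)); assert (P0 := Hp n).
  assert (0 < jac_mu s * jac s (jac_mu s) (S n)) by now apply Rmult_lt_0_compat.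
  nra.
Qed.

Lemma jac_mu_le_1 (s : R) : 0 <= s -> jac_mu s <= 1.
Proof. intros Hs; apply jac_mu_le; [assumption|now apply jac_pos_1]. Qed.

Lemma jac_mu_gt_0 (s : R) : 0 <= s -> 0 < jac_mu s.
Proof. intros Hs; apply (jac_pos_gt0 s), jac_mu_pos, Hs. Qed.

(** The rate [1 / 4] is the square of [1 / 2]: one factor absorbs the weight [k^2], the other stays
    summable. Uniformity on [[s0, s1]] serves the continuity of the energy in [s]. *)
Lemma jac_mu_uniform_bound (s0 s1 : R) : 0 < s0 ->
  exists B, 0 < B /\ forall s, s0 <= s <= s1 -> forall n, jac s (jac_mu s) n <= B * (/ 4) ^ n.
Proof.
  intros Hs0.
  (* On an initial segment each step multiplies by at most a factor independent of [s], because
     [jac_mu s <= 1]. *)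
  assert (G : forall k, exists B, 0 < B /\ forall s, s0 <= s <= s1 ->
     forall n, (n <= k)%nat -> jac s (jac_mu s) n <= B * (/ 4) ^ n).
  { induction k as [|k [B [HB IH]]].
    - exists 1; split; [lra|]; intros s Hs n Hn; replace n with O by lia; rewrite jac_0; simpl; lra.
    - set (c := 2 * (s1 * INR k ^ 2 + 1)).
      exists (B * (4 * Rabs c + 1)).
      assert (Hc0 := Rabs_pos c).
      split; [apply Rmult_lt_0_compat; lra|].
      intros s Hs n Hn. destruct (Nat.eq_dec n (S k)) as [->|Hne].
      + specialize (IH s Hs k (le_n k)).
        assert (Hp : jac_pos s (jac_mu s)) by (apply jac_mu_pos; lra).
        assert (Hm := jac_mu_le_1 s ltac:(lra)).
        assert (P := Hp k).
        assert (J : jac s (jac_mu s) (S k) <= Rabs c * jac s (jac_mu s) k).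
        { apply Rle_trans with (c * jac s (jac_mu s) k).
          2:{ apply Rmult_le_compat_r; [lra|apply Rle_abs]. }
          assert (HK : 2 * (s * INR k ^ 2 + jac_mu s) <= c).
          { unfold c; assert (Q := pow2_ge_0 (INR k)).
            assert (s * INR k ^ 2 <= s1 * INR k ^ 2) by (apply Rmult_le_compat_r; lra). lra. }
          destruct k as [|k].
          - rewrite jac_0, jac_1. unfold c; simpl; lra.
          - rewrite jac_SS. assert (P' := Hp k).
            apply Rmult_le_compat_r with (r := jac s (jac_mu s) (S k)) in HK; lra. }
        apply Rle_trans with (1 := J).
        replace (B * (4 * Rabs c + 1) * (/ 4) ^ S k)
          with (Rabs c * (B * (/ 4) ^ k) + B * (/ 4) ^ S k) by (simpl; field).
        assert (0 < B * (/ 4) ^ S k) by (apply Rmult_lt_0_compat; [assumption|apply pow_lt; lra]).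
        apply Rmult_le_compat_l with (r := Rabs c) in IH; lra.
      + apply Rle_trans with (B * (/ 4) ^ n); [apply IH; [assumption|lia]|].
        apply Rmult_le_compat_r; [apply pow_le; lra|].
        rewrite <- (Rmult_1_r B) at 1. apply Rmult_le_compat_l; lra. }
  (* Beyond this index [s n^2 >= 4], so [jac_mu_decay] gains the factor [1 / 4] at each step. *)
  destruct (nfloor_ex (4 / s0)) as [N HN].
  { apply Rlt_le, Rdiv_lt_0_compat; lra. }
  assert (HN' : 4 < s0 * INR (S N)).
  { rewrite S_INR. destruct HN as [_ HN].
    apply Rmult_lt_compat_l with (r := s0) in HN; [|assumption].
    replace (s0 * (4 / s0)) with 4 in HN by (field; lra). lra. }
  destruct (G (S N)) as [B [HB H]].
  exists B; split; [assumption|]. intros s Hs n.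
  destruct (Nat.le_gt_cases n (S N)) as [Hn|Hn]; [now apply H|].
  replace n with ((n - S N) + S N)%nat by lia.
  set (j := (n - S N)%nat); clearbody j.
  assert (L : forall i, 4 <= s * INR (i + S N) ^ 2).
  { intros i.
    assert (1 <= INR (S N)) by (rewrite S_INR; assert (X := pos_INR N); lra).
    assert (INR (S N) <= INR (i + S N)) by (apply le_INR; lia).
    apply Rle_trans with (s0 * INR (S N)); [lra|].
    apply Rmult_le_compat; nra. }
  assert (Hp : jac_pos s (jac_mu s)) by (apply jac_mu_pos; lra).
  induction j as [|j IH]; [now apply H|].
  change (S j + S N)%nat with (S (j + S N)).
  assert (D := jac_mu_decay s (j + S N) ltac:(lra) ltac:(specialize (L j); lra)).
  specialize (L (S j)). change (S j + S N)%nat with (S (j + S N)) in L.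
  assert (P := Hp (S (j + S N))).
  change (B * (/ 4) ^ S (j + S N)) with (B * (/ 4 * (/ 4) ^ (j + S N))).
  nra.
Qed.

(* A bounded solution above the critical parameter is excluded by the growth of its
   Wronskian with the ground state. *)
Lemma jac_unbounded (s m B : R) :
  0 < s -> jac_mu s < m -> ~ (forall n, Rabs (jac s m n) <= B).
Proof.
  intros Hs Hm HB; set (m0 := jac_mu s).
  assert (Hp : jac_pos s m0) by (apply jac_mu_pos; lra).
  assert (Hq : jac_pos s m) by (apply jac_pos_above_mu; lra).
  assert (W : forall n, m - m0 <= jac s m (S n) * jac s m0 n - jac s m n * jac s m0 (S n)).
  { induction n as [|n IH].
    - rewrite !jac_0, !jac_1; lra.
    - rewrite !jac_SS. specialize (Hp (S n)); specialize (Hq (S n)).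
      assert (0 < (m - m0) * (jac s m (S n) * jac s m0 (S n)))
        by (apply Rmult_lt_0_compat; [unfold m0; lra|now apply Rmult_lt_0_compat]).
      match goal with |- _ <= ?e => replace e with
        (2 * ((m - m0) * (jac s m (S n) * jac s m0 (S n)))
         + (jac s m (S n) * jac s m0 n - jac s m n * jac s m0 (S n))) by ring end.
      lra. }
  destruct (jac_mu_uniform_bound s s Hs) as [C [HC H]].
  specialize (H s ltac:(lra)). fold m0 in H.
  assert (B0 : 1 <= B) by (specialize (HB O); rewrite jac_0, Rabs_R1 in HB; lra).
  destruct (pow_lt_1_zero (/ 4) ltac:(rewrite Rabs_pos_eq; lra) ((m - m0) / (B * C))) as [N HN].
  { apply Rdiv_lt_0_compat; [unfold m0; lra|apply Rmult_lt_0_compat; lra]. }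
  specialize (HN N (le_n N)). rewrite Rabs_pos_eq in HN by (apply pow_le; lra).
  specialize (W N); specialize (H N); specialize (HB (S N)).
  apply Rle_trans with (1 := Rle_abs _) in HB.
  assert (A1 := Hp N); assert (A2 := Hp (S N)); assert (A3 := Hq N).
  assert (jac s m (S N) * jac s m0 N <= B * (C * (/ 4) ^ N)).
  { apply Rmult_le_compat; try lra. apply Rlt_le, Hq. }
  assert (0 < jac s m N * jac s m0 (S N)) by now apply Rmult_lt_0_compat.
  apply Rmult_lt_compat_l with (r := B * C) in HN; [|apply Rmult_lt_0_compat; lra].
  replace (B * C * ((m - m0) / (B * C))) with (m - m0) in HN by (field; split; lra).
  lra.
Qed.

Definition ground (s : R) (k : Z) : R := jac s (jac_mu s) (Z.abs_nat k).

Lemma ground_pos (s : R) (k : Z) : 0 <= s -> 0 < ground s k.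
Proof. intros Hs; now apply jac_mu_pos. Qed.

Lemma ground_opp (s : R) (k : Z) : ground s (- k) = ground s k.
Proof. unfold ground; f_equal; lia. Qed.

Lemma ground_0 (s : R) : ground s 0 = 1. Proof. reflexivity. Qed.

(** At [k = 0] evenness reduces the recursion to [2 * ground s 1 = 2 * jac_mu s], which is why [jac]
    takes the value [m] at index [1]. *)
Lemma ground_rec (s : R) (k : Z) :
  ground s (k + 1) + ground s (k - 1) = 2 * (s * IZR k ^ 2 + jac_mu s) * ground s k.
Proof.
  assert (P : forall n : nat, ground s (Z.of_nat n + 1) + ground s (Z.of_nat n - 1)
    = 2 * (s * INR n ^ 2 + jac_mu s) * ground s (Z.of_nat n)).
  { intros [|n]; unfold ground.
    - change (Z.abs_nat (Z.of_nat 0 + 1)) with 1%nat.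
      change (Z.abs_nat (Z.of_nat 0 - 1)) with 1%nat.
      change (Z.abs_nat (Z.of_nat 0)) with 0%nat. rewrite jac_0, jac_1; simpl; ring.
    - replace (Z.abs_nat (Z.of_nat (S n) + 1)) with (S (S n)) by lia.
      replace (Z.abs_nat (Z.of_nat (S n) - 1)) with n by lia.
      replace (Z.abs_nat (Z.of_nat (S n))) with (S n) by lia.
      rewrite jac_SS; ring. }
  destruct (Z_le_gt_dec 0 k) as [Hk|Hk].
  - specialize (P (Z.to_nat k)). rewrite INR_IZR_INZ, Z2Nat.id in P by assumption. exact P.
  - specialize (P (Z.to_nat (- k))). rewrite INR_IZR_INZ, Z2Nat.id in P by lia.
    rewrite <- (ground_opp s (k + 1)), <- (ground_opp s (k - 1)), <- (ground_opp s k).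
    replace (- (k + 1))%Z with (- k - 1)%Z by lia.
    replace (- (k - 1))%Z with (- k + 1)%Z by lia.
    rewrite opp_IZR in P. rewrite <- Rsqr_pow2, <- Rsqr_neg, Rsqr_pow2 in P. lra.
Qed.

(** * Uniformly dominated series of functions *)

(** Weierstrass test: at every [x] the remainder is at most the remainder of [M], so [N] does not
    depend on [x]. *)
Lemma Series_uniform_tail (phi : nat -> R -> R) (M : nat -> R) (eps : R) :
  (forall n x, Rabs (phi n x) <= M n) -> ex_series M -> 0 < eps ->
  exists N, forall n, (N <= n)%nat -> forall x,
    Rabs (sum_n (fun k => phi k x) n - Series (fun k => phi k x)) < eps.
Proof.
  intros HM Hs Heps.
  assert (L : is_lim_seq (sum_n M) (Series M)) by exact (Series_correct _ Hs).
  apply is_lim_seq_spec in L. destruct (L (mkposreal eps Heps)) as [N HN]; simpl in HN.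
  exists N; intros n Hn x; specialize (HN n Hn).
  assert (Ha : ex_series (fun k => Rabs (phi k x))).
  { apply (ex_series_le (K := R_AbsRing) (V := R_CompleteNormedModule) _ M); [|assumption].
    intros k; change (Rabs (Rabs (phi k x)) <= M k); rewrite Rabs_Rabsolu; apply HM. }
  assert (Hx := ex_series_Rabs _ Ha).
  assert (E1 := Series_incr_n (fun k => phi k x) (S n) (Nat.lt_0_succ n) Hx).
  assert (E2 := Series_incr_n M (S n) (Nat.lt_0_succ n) Hs).
  simpl Init.Nat.pred in *. rewrite <- sum_n_Reals in E1, E2.
  rewrite E1. rewrite E2 in HN.
  apply Rle_lt_trans with (2 := HN).
  match goal with |- Rabs (?s - (?s + ?t)) <= Rabs (?u - (?u + ?v)) =>
    replace (s - (s + t)) with (- t) by ring; replace (u - (u + v)) with (- v) by ring end.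
  rewrite !Rabs_Ropp.
  assert (Ha' : ex_series (fun k => Rabs (phi (S n + k)%nat x)))
    by (apply (ex_series_incr_n (fun k => Rabs (phi k x))); assumption).
  apply Rle_trans with (1 := Series_Rabs _ Ha').
  apply Rle_trans with (2 := Rle_abs _).
  apply Series_le; [intros k; split; [apply Rabs_pos|apply HM]|].
  apply (ex_series_incr_n M); assumption.
Qed.

Lemma sum_n_continuous (phi : nat -> R -> R) (x : R) (n : nat) :
  (forall k, continuous (phi k) x) -> continuous (fun t => sum_n (fun k => phi k t) n) x.
Proof.
  intros H; induction n as [|n IH].
  - apply (continuous_ext (phi O)); [intros; now rewrite sum_O|apply H].
  - apply (continuous_ext (fun t => plus (sum_n (fun k => phi k t) n) (phi (S n) t)));
      [intros; now rewrite sum_Sn|].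
    apply (continuous_plus (V := R_NormedModule)); [exact IH|apply H].
Qed.

Lemma Series_continuous (phi : nat -> R -> R) (M : nat -> R) (x : R) :
  (forall n x, Rabs (phi n x) <= M n) -> ex_series M ->
  (forall n, continuous (phi n) x) -> continuous (fun t => Series (fun n => phi n t)) x.
Proof.
  intros HM Hs Hc. apply filterlim_locally; intros [eps Heps].
  destruct (Series_uniform_tail phi M (eps / 3) HM Hs ltac:(lra)) as [N HN].
  assert (C := sum_n_continuous phi x N Hc).
  assert (C' := proj1 (filterlim_locally _ _) C (mkposreal (eps / 3) ltac:(lra))).
  revert C'; apply filter_imp; intros y Hy.
  change (Rabs (Series (fun n => phi n y) - Series (fun n => phi n x)) < eps).
  change (Rabs (sum_n (fun k => phi k y) N - sum_n (fun k => phi k x) N) < eps / 3) in Hy.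
  assert (A := HN N (le_n N) x); assert (B := HN N (le_n N) y).
  apply Rabs_def2 in A; apply Rabs_def2 in B; apply Rabs_def2 in Hy. apply Rabs_def1; lra.
Qed.

Lemma RInt_sum_n (phi : nat -> R -> R) (a b : R) (n : nat) :
  (forall k x, continuous (phi k) x) ->
  is_RInt (fun x => sum_n (fun k => phi k x) n) a b (sum_n (fun k => RInt (phi k) a b) n).
Proof.
  intros Hc.
  assert (H : forall k, is_RInt (phi k) a b (RInt (phi k) a b)).
  { intros k; apply (RInt_correct (V := R_CompleteNormedModule)).
    apply (ex_RInt_continuous (V := R_CompleteNormedModule)); intros; apply Hc. }
  induction n as [|n IH].
  - rewrite sum_O; apply (is_RInt_ext (phi O)); [intros; now rewrite sum_O|apply H].
  - rewrite sum_Sn; apply (is_RInt_ext (fun x => plus (sum_n (fun k => phi k x) n) (phi (S n) x)));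
      [intros; now rewrite sum_Sn|].
    apply (is_RInt_plus (V := R_NormedModule)); [exact IH|apply H].
Qed.

(** The domination is over the whole line because [filterlim_RInt] takes uniform convergence of
    functions on [R], not only on the interval of integration. *)
Lemma RInt_Series (phi : nat -> R -> R) (M : nat -> R) (a b : R) :
  (forall n x, Rabs (phi n x) <= M n) -> ex_series M -> (forall n x, continuous (phi n) x) ->
  is_series (fun n => RInt (phi n) a b) (RInt (fun x => Series (fun n => phi n x)) a b).
Proof.
  intros HM Hs Hc.
  destruct (filterlim_RInt (V := R_CompleteNormedModule) (fun n x => sum_n (fun k => phi k x) n) a b
     eventually eventually_filter (fun x => Series (fun n => phi n x))
     (fun n => sum_n (fun k => RInt (phi k) a b) n)) as [l [H1 H2]].
  - intros n; now apply RInt_sum_n.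
  - intros P [eps HP].
    destruct (Series_uniform_tail phi M eps HM Hs (cond_pos eps)) as [N HN].
    exists N; intros n Hn; apply HP; intros x. exact (HN n Hn x).
  - rewrite (is_RInt_unique _ _ _ _ H2). exact H1.
Qed.

Lemma ex_zsum_dominated (phi : Z -> R -> R) (M : Z -> R) (x : R) :
  (forall k x, Rabs (phi k x) <= M k) -> ex_zsum M -> ex_zsum (fun k => phi k x).
Proof. intros H HM; apply (ex_zsum_le _ M); [intros; apply H|assumption]. Qed.

Lemma zsum_continuous (phi : Z -> R -> R) (M : Z -> R) (x : R) :
  (forall k x, Rabs (phi k x) <= M k) -> ex_zsum M ->
  (forall k, continuous (phi k) x) -> continuous (fun t => zsum (fun k => phi k t)) x.
Proof.
  intros HM [H1 H2] Hc; unfold zsum.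
  apply (continuous_plus (V := R_NormedModule)
    (fun t => Series (fun n => phi (Z.of_nat n) t)) (fun t => Series (fun n => phi (- Z.of_nat (S n))%Z t))).
  - apply (Series_continuous (fun n => phi (Z.of_nat n)) (fun n => M (Z.of_nat n))); auto.
  - apply (Series_continuous (fun n => phi (- Z.of_nat (S n))%Z) (fun n => M (- Z.of_nat (S n))%Z)); auto.
Qed.

Lemma RInt_zsum (phi : Z -> R -> R) (M : Z -> R) (a b : R) :
  (forall k x, Rabs (phi k x) <= M k) -> ex_zsum M -> (forall k x, continuous (phi k) x) ->
  RInt (fun x => zsum (fun k => phi k x)) a b = zsum (fun k => RInt (phi k) a b).
Proof.
  intros HM [H1 H2] Hc; unfold zsum.
  assert (C1 : forall x, continuous (fun t => Series (fun n => phi (Z.of_nat n) t)) x).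
  { intros x; apply (Series_continuous (fun n => phi (Z.of_nat n)) (fun n => M (Z.of_nat n))); auto. }
  assert (C2 : forall x, continuous (fun t => Series (fun n => phi (- Z.of_nat (S n))%Z t)) x).
  { intros x; apply (Series_continuous (fun n => phi (- Z.of_nat (S n))%Z) (fun n => M (- Z.of_nat (S n))%Z)); auto. }
  rewrite (RInt_plus (V := R_CompleteNormedModule)
    (fun t => Series (fun n => phi (Z.of_nat n) t)) (fun t => Series (fun n => phi (- Z.of_nat (S n))%Z t)))
    by (apply (ex_RInt_continuous (V := R_CompleteNormedModule)); auto).
  assert (E1 := RInt_Series (fun n => phi (Z.of_nat n)) (fun n => M (Z.of_nat n)) a b
    (fun n x => HM _ x) H1 (fun n x => Hc _ x)).
  assert (E2 := RInt_Series (fun n => phi (- Z.of_nat (S n))%Z) (fun n => M (- Z.of_nat (S n))%Z) a b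
    (fun n x => HM _ x) H2 (fun n x => Hc _ x)).
  apply is_series_unique in E1; apply is_series_unique in E2.
  cbv beta in E1, E2. rewrite <- E1, <- E2. reflexivity.
Qed.

(* Termwise differentiation: by [RInt_zsum] the sum is a primitive of [zsum psi]. *)
Lemma zsum_is_derive (phi psi : Z -> R -> R) (M N : Z -> R) (x : R) :
  (forall k x, Rabs (phi k x) <= N k) -> ex_zsum N ->
  (forall k x, Rabs (psi k x) <= M k) -> ex_zsum M ->
  (forall k x, is_derive (phi k) x (psi k x)) -> (forall k x, continuous (psi k) x) ->
  is_derive (fun t => zsum (fun k => phi k t)) x (zsum (fun k => psi k x)).
Proof.
  intros HN HN' HM HM' Hd Hc.
  assert (C : forall x, continuous (fun t => zsum (fun k => psi k t)) x)
    by (intros; apply (zsum_continuous psi M); auto).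
  apply (is_derive_ext (fun t => plus (zsum (fun k => phi k 0)) (RInt (fun t => zsum (fun k => psi k t)) 0 t))).
  - intros t. rewrite (RInt_zsum psi M) by auto.
    rewrite (zsum_ext (fun k => RInt (psi k) 0 t) (fun k => phi k t - phi k 0)).
    + rewrite zsum_minus by (apply (ex_zsum_dominated phi N); assumption). unfold plus; simpl; ring.
    + intros k; apply is_RInt_unique. apply (is_RInt_derive (V := R_CompleteNormedModule) (phi k)); auto.
  - evar_last.
    + apply (is_derive_plus (V := R_NormedModule)).
      * apply (is_derive_const (V := R_NormedModule)).
      * apply (is_derive_RInt (V := R_NormedModule) (fun t => zsum (fun k => psi k t)) _ 0); [|apply C].
        apply filter_forall; intros y. apply (RInt_correct (V := R_CompleteNormedModule)).
        apply (ex_RInt_continuous (V := R_CompleteNormedModule)); auto.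
    + apply plus_zero_l.
Qed.

Lemma ex_zsum_geom : ex_zsum (fun k => (/ 2) ^ Z.abs_nat k).
Proof.
  assert (G : ex_series (fun n => (/ 2) ^ n)).
  { exists (/ (1 - / 2)); apply is_series_geom; rewrite Rabs_pos_eq; lra. }
  split.
  - revert G; apply ex_series_ext; intros n; now rewrite Zabs2Nat.id.
  - apply (ex_series_ext (fun n => (/ 2) ^ S n)).
    + intros n; f_equal; lia.
    + now apply (ex_series_incr_1 (fun n => (/ 2) ^ n)).
Qed.

Lemma sqr_le_pow2 (n : nat) : INR n ^ 2 * (/ 4) ^ n <= 2 * (/ 2) ^ n.
Proof.
  assert (H : INR n ^ 2 <= 2 * 2 ^ n).
  (* [(n + 1)^2 <= 2 n^2] holds only from [n = 3] on, so the induction starts there. *)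
  { assert (P := pow_lt 2). destruct n as [|[|[|n]]]; try (simpl; lra).
    assert (Hn : INR (S (S (S n))) ^ 2 <= 2 * 2 ^ S (S (S n)) /\ 3 <= INR (S (S (S n)))).
    { induction n as [|n IH].
      - simpl; lra.
      - rewrite (S_INR (S (S (S n)))).
        change (2 ^ S (S (S (S n)))) with (2 * 2 ^ S (S (S n))). nra. }
    tauto. }
  replace ((/ 4) ^ n) with ((/ 2) ^ n * (/ 2) ^ n) by (rewrite <- Rpow_mult_distr; f_equal; lra).
  assert (Q : 2 ^ n * (/ 2) ^ n = 1).
  { rewrite <- Rpow_mult_distr; replace (2 * / 2) with 1 by lra; apply pow1. }
  assert (P : 0 < (/ 2) ^ n) by (apply pow_lt; lra).
  apply Rmult_le_compat_r with (r := (/ 2) ^ n) in H; [|lra].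
  nra.
Qed.

Lemma IZR_sqr_abs_nat (k : Z) : IZR k ^ 2 = INR (Z.abs_nat k) ^ 2.
Proof. rewrite INR_IZR_INZ, Nat2Z.inj_abs_nat, abs_IZR, pow2_abs; reflexivity. Qed.

Lemma ground_uniform_bound (s0 s1 : R) : 0 < s0 -> exists B, 0 < B /\ forall s, s0 <= s <= s1 ->
  forall k, ground s k <= B * (/ 2) ^ Z.abs_nat k /\ IZR k ^ 2 * ground s k <= B * (/ 2) ^ Z.abs_nat k
   /\ ground s k <= B.
Proof.
  intros Hs; destruct (jac_mu_uniform_bound s0 s1 Hs) as [B [HB H]].
  exists (2 * B); split; [lra|]. intros s Hs' k; specialize (H s Hs' (Z.abs_nat k)).
  fold (ground s k) in H. rewrite IZR_sqr_abs_nat.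
  set (n := Z.abs_nat k) in *; clearbody n.
  assert (P : 0 < (/ 2) ^ n) by (apply pow_lt; lra).
  assert (P' : (/ 4) ^ n <= (/ 2) ^ n) by (apply pow_incr; lra).
  assert (P1 : (/ 4) ^ n <= 1) by (rewrite <- (pow1 n); apply pow_incr; lra).
  assert (Q := sqr_le_pow2 n). assert (N := pow2_ge_0 (INR n)).
  repeat split.
  - nra.
  - apply Rle_trans with (INR n ^ 2 * (B * (/ 4) ^ n)); [apply Rmult_le_compat_l; lra|]. nra.
  - nra.
Qed.

(** * The ground state representation and the choice of the multiplier *)

(** The forms take real sequences: the operator is real and symmetric, so the real and imaginary
    parts of a state contribute separately. *)
Definition norm2 (a : Z -> R) : R := zsum (fun k => a k ^ 2).
Definition kinetic (a : Z -> R) : R := zsum (fun k => IZR k ^ 2 * a k ^ 2).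
(** The form of [1 - cos Q] in Fourier coefficients, as [cosQ_exp_fourier_fun] confirms. *)
Definition hopping (a : Z -> R) : R := zsum (fun k => (a (k + 1)%Z - a k) ^ 2) / 2.
Definition finite_energy (a : Z -> R) : Prop :=
  ex_zsum (fun k => a k ^ 2) /\ ex_zsum (fun k => IZR k ^ 2 * a k ^ 2).
Definition defect_term (s : R) (a : Z -> R) (k : Z) : R :=
  ground s k * ground s (k + 1) * (a (k + 1)%Z / ground s (k + 1) - a k / ground s k) ^ 2.
Definition defect (s : R) (a : Z -> R) : R := zsum (defect_term s a) / 2.

Lemma ex_zsum_hopping (a : Z -> R) :
  ex_zsum (fun k => a k ^ 2) -> ex_zsum (fun k => (a (k + 1)%Z - a k) ^ 2).
Proof.
  intros H; apply (ex_zsum_le _ (fun k => 2 * (a (k + 1)%Z ^ 2 + a k ^ 2))).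
  - intros k; rewrite Rabs_pos_eq by apply pow2_ge_0.
    assert (X := pow2_ge_0 (a (k + 1)%Z + a k)). nra.
  - apply ex_zsum_scal, ex_zsum_plus; [|assumption]. now apply (ex_zsum_shift (fun k => a k ^ 2)).
Qed.

(* Expands [(a_{k+1} - a_k)^2] around [a = ground s * (a / ground s)]; the eigenvalue equation
   collects the diagonal terms. *)
Lemma ground_representation (s : R) (a : Z -> R) : 0 < s -> finite_energy a ->
  ex_zsum (defect_term s a) /\
  hopping a + s * kinetic a = (1 - jac_mu s) * norm2 a + defect s a.
Proof.
  intros Hs [HN HK].
  assert (U := fun k => ground_pos s k ltac:(lra)).
  (* One of the two ratios grows like [k^2] at each end, so summability of [al] and [be] is not
     immediate. Both are nonnegative, and the eigenvalue equation expresses their sum through the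
     norm and the energy. *)
  set (al := fun k => a k ^ 2 * (ground s (k + 1) / ground s k)).
  set (be := fun k => a k ^ 2 * (ground s (k - 1) / ground s k)).
  assert (Pal : forall k, 0 <= al k).
  { intros k; apply Rmult_le_pos; [apply pow2_ge_0|apply Rlt_le, Rdiv_lt_0_compat; apply U]. }
  assert (Pbe : forall k, 0 <= be k).
  { intros k; apply Rmult_le_pos; [apply pow2_ge_0|apply Rlt_le, Rdiv_lt_0_compat; apply U]. }
  assert (S : forall k, al k + be k = 2 * (s * (IZR k ^ 2 * a k ^ 2) + jac_mu s * a k ^ 2)).
  { intros k; unfold al, be.
    replace (a k ^ 2 * (ground s (k + 1) / ground s k) + a k ^ 2 * (ground s (k - 1) / ground s k))
      with (a k ^ 2 * ((ground s (k + 1) + ground s (k - 1)) / ground s k))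
      by (field; apply Rgt_not_eq, U).
    rewrite ground_rec; field; apply Rgt_not_eq, U. }
  assert (Ex : ex_zsum (fun k => 2 * (s * (IZR k ^ 2 * a k ^ 2) + jac_mu s * a k ^ 2))).
  { apply ex_zsum_scal, ex_zsum_plus; apply ex_zsum_scal; assumption. }
  assert (Eal : ex_zsum al).
  { apply (ex_zsum_le al _) with (2 := Ex); intros k.
    rewrite <- S, Rabs_pos_eq by apply Pal; specialize (Pbe k); lra. }
  assert (Ebe : ex_zsum be).
  { apply (ex_zsum_le be _) with (2 := Ex); intros k.
    rewrite <- S, Rabs_pos_eq by apply Pbe; specialize (Pal k); lra. }
  assert (EW := ex_zsum_hopping a HN).
  assert (HN1 := ex_zsum_shift (fun k => a k ^ 2) HN).
  assert (Ebe1 := ex_zsum_shift be Ebe).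
  (* Shifting [be] by one places both diagonal terms on the edge from [k] to [k + 1], where they
     complete the square. *)
  assert (D : forall k, be (k + 1)%Z + al k + ((a (k + 1)%Z - a k) ^ 2 - (a (k + 1)%Z ^ 2 + a k ^ 2))
    = defect_term s a k).
  { intros k; unfold al, be, defect_term. replace (k + 1 - 1)%Z with k by lia.
    field; split; apply Rgt_not_eq, U. }
  assert (ED1 : ex_zsum (fun k => be (k + 1)%Z + al k)) by now apply ex_zsum_plus.
  assert (ED2 : ex_zsum (fun k => a (k + 1)%Z ^ 2 + a k ^ 2)) by now apply ex_zsum_plus.
  assert (ED3 : ex_zsum (fun k => (a (k + 1)%Z - a k) ^ 2 - (a (k + 1)%Z ^ 2 + a k ^ 2)))
    by now apply ex_zsum_minus.
  split.
  - apply (ex_zsum_ext _ _ D), ex_zsum_plus; assumption.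
  - unfold defect; rewrite <- (zsum_ext _ _ D).
    rewrite zsum_plus, zsum_plus, zsum_minus, zsum_plus by assumption.
    rewrite (zsum_shift be Ebe), (zsum_shift (fun k => a k ^ 2) HN).
    assert (T : zsum be + zsum al = 2 * (s * kinetic a + jac_mu s * norm2 a)).
    { rewrite Rplus_comm, <- zsum_plus by assumption.
      rewrite (zsum_ext _ _ S), zsum_scal, zsum_plus by (apply ex_zsum_scal; assumption).
      rewrite !zsum_scal; reflexivity. }
    rewrite T; unfold hopping; fold (norm2 a); field.
Qed.

Lemma defect_term_nonneg (s : R) (a : Z -> R) (k : Z) : 0 < s -> 0 <= defect_term s a k.
Proof.
  intros Hs; unfold defect_term. apply Rmult_le_pos; [|apply pow2_ge_0].
  apply Rmult_le_pos; apply Rlt_le, ground_pos; lra.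
Qed.

Lemma defect_nonneg (s : R) (a : Z -> R) : 0 < s -> finite_energy a -> 0 <= defect s a.
Proof.
  intros Hs Ha; unfold defect; apply Rdiv_le_0_compat; [|lra].
  apply zsum_nonneg; [intros; now apply defect_term_nonneg|].
  now apply ground_representation.
Qed.

(** A vanishing sum of nonnegative terms makes [a / ground s] equal at neighbours, hence constant on
    the integers. *)
Lemma defect_zero (s : R) (a : Z -> R) : 0 < s -> finite_energy a -> defect s a <= 0 ->
  forall k, a k = a 0%Z * ground s k.
Proof.
  intros Hs Ha H0.
  assert (U := fun k => ground_pos s k ltac:(lra)).
  assert (T : forall k, a (k + 1)%Z / ground s (k + 1) = a k / ground s k).
  { intros k.
    assert (T := zsum_nonneg_zero (defect_term s a) (fun k => defect_term_nonneg s a k Hs)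
      (proj1 (ground_representation s a Hs Ha)) ltac:(unfold defect in H0; lra) k).
    unfold defect_term in T. apply Rmult_integral in T; destruct T as [T|T].
    - assert (P := Rmult_lt_0_compat _ _ (U k) (U (k + 1)%Z)); lra.
    - apply Rmult_integral in T; destruct T as [T|T]; lra. }
  assert (C : forall k, a k / ground s k = a 0%Z).
  { intros k; pattern k; apply Z.bi_induction.
    - intros x y ->; tauto.
    - rewrite ground_0; field.
    - intros j; rewrite <- (T j), Z.add_1_r; tauto. }
  intros k; rewrite <- (C k). field. apply Rgt_not_eq, U.
Qed.

Lemma defect_scal_ground (s t : R) : 0 < s -> defect s (fun k => t * ground s k) = 0.
Proof.
  intros Hs; unfold defect.
  assert (U := fun k => ground_pos s k ltac:(lra)).
  rewrite (zsum_ext _ (fun k => 0 * 0)).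
  - rewrite (zsum_scal 0 (fun _ => 0)); field.
  - intros k; unfold defect_term; field; split; apply Rgt_not_eq, U.
Qed.

Lemma hopping_scal (t : R) (a : Z -> R) : hopping (fun k => t * a k) = t ^ 2 * hopping a.
Proof.
  unfold hopping, Rdiv; rewrite <- Rmult_assoc, <- zsum_scal; f_equal; apply zsum_ext; intros; ring.
Qed.

Lemma ground_finite_energy (s : R) : 0 < s -> finite_energy (ground s).
Proof.
  intros Hs; destruct (ground_uniform_bound s s Hs) as [B [HB H]].
  specialize (H s ltac:(lra)).
  assert (U := fun k => ground_pos s k ltac:(lra)).
  split; apply (ex_zsum_le _ (fun k => (B * B) * (/ 2) ^ Z.abs_nat k));
    try apply ex_zsum_scal, ex_zsum_geom; intros k; specialize (H k); specialize (U k).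
  - rewrite Rabs_pos_eq by apply pow2_ge_0. simpl. nra.
  - assert (0 <= IZR k ^ 2) by apply pow2_ge_0.
    assert (0 <= IZR k ^ 2 * ground s k) by (apply Rmult_le_pos; lra).
    rewrite Rabs_pos_eq by (apply Rmult_le_pos; apply pow2_ge_0).
    replace (IZR k ^ 2 * ground s k ^ 2) with (IZR k ^ 2 * ground s k * ground s k) by ring.
    nra.
Qed.

Lemma ground_balance (s : R) : 0 < s ->
  hopping (ground s) + s * kinetic (ground s) = (1 - jac_mu s) * norm2 (ground s).
Proof.
  intros Hs; destruct (ground_representation s (ground s) Hs (ground_finite_energy s Hs)) as [_ H].
  rewrite H.
  assert (D := defect_scal_ground s 1 Hs).
  assert (E : defect s (fun k => 1 * ground s k) = defect s (ground s)).
  { unfold defect; f_equal; apply zsum_ext; intros; unfold defect_term; rewrite !Rmult_1_l; reflexivity. }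
  lra.
Qed.

Lemma norm2_ground_ge1 (s : R) : 0 < s -> 1 <= norm2 (ground s).
Proof.
  intros Hs. assert (H := zsum_nonneg_ge_term (fun k => ground s k ^ 2) 0
    (fun k => pow2_ge_0 _) (proj1 (ground_finite_energy s Hs))).
  cbv beta in H; rewrite ground_0 in H; unfold norm2; lra.
Qed.

Lemma hopping_nonneg (a : Z -> R) : ex_zsum (fun k => a k ^ 2) -> 0 <= hopping a.
Proof.
  intros H; unfold hopping; apply Rdiv_le_0_compat; [|lra].
  apply zsum_nonneg; [intros; apply pow2_ge_0|now apply ex_zsum_hopping].
Qed.

Lemma kinetic_nonneg (a : Z -> R) : finite_energy a -> 0 <= kinetic a.
Proof.
  intros [_ H]; apply zsum_nonneg; [|assumption].
  intros; apply Rmult_le_pos; apply pow2_ge_0.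
Qed.

(* Testing the form at [s'] with the ground state at [s]: the ground state energy
   [1 - jac_mu s] is concave in [s], with supergradient [kinetic / norm2]. *)
Lemma jac_mu_supergradient (s s' : R) : 0 < s -> 0 < s' ->
  (1 - jac_mu s') * norm2 (ground s) + defect s' (ground s)
  = (1 - jac_mu s) * norm2 (ground s) + (s' - s) * kinetic (ground s).
Proof.
  intros Hs Hs'.
  destruct (ground_representation s' (ground s) Hs' (ground_finite_energy s Hs)) as [_ H].
  assert (H1 := ground_balance s Hs). lra.
Qed.

(** Zero defect makes the two ground states equal; their entries at [1] identify [jac_mu], and those
    at [2] then identify [s]. Uniqueness of the argmax rests on this. *)
Lemma defect_ground_inj (s s' : R) : 0 < s -> 0 < s' -> defect s' (ground s) <= 0 -> s = s'.
Proof.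
  intros Hs Hs' H.
  assert (E := defect_zero s' (ground s) Hs' (ground_finite_energy s Hs) H).
  rewrite ground_0 in E.
  assert (E1 := E 1%Z); assert (E2 := E 2%Z). unfold ground in E1, E2.
  change (Z.abs_nat 1) with 1%nat in E1. change (Z.abs_nat 2) with 2%nat in E2.
  rewrite !jac_SS, !jac_0, !jac_1 in E2; rewrite !jac_1 in E1. rewrite E1 in E2.
  assert (P := jac_mu_gt_0 s' ltac:(lra)). simpl in E2.
  apply Rmult_eq_reg_r with (jac_mu s'); lra.
Qed.

(** In the balance identity the hopping is nonnegative and [jac_mu s] is positive. The resulting
    bound [1 / s] on the energy gives a point where it is below [E] and a Lipschitz constant for
    [jac_mu]. *)
Lemma kinetic_ground_bound (s : R) : 0 < s -> s * kinetic (ground s) < norm2 (ground s).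
Proof.
  intros Hs; assert (H := ground_balance s Hs).
  assert (W := hopping_nonneg _ (proj1 (ground_finite_energy s Hs))).
  assert (N := norm2_ground_ge1 s Hs). assert (P := jac_mu_gt_0 s ltac:(lra)).
  assert (0 < jac_mu s * norm2 (ground s)) by (apply Rmult_lt_0_compat; lra).
  lra.
Qed.

(** Each ground state is tested at the other parameter; the slopes [kinetic / norm2] are below
    [1 / s0]. *)
Lemma jac_mu_lipschitz (s0 s s' : R) : 0 < s0 -> s0 <= s -> s0 <= s' ->
  Rabs (jac_mu s' - jac_mu s) <= Rabs (s' - s) / s0.
Proof.
  intros H0 H1 H2.
  assert (G : forall s s', s0 <= s -> s0 <= s' -> jac_mu s - jac_mu s' <= Rabs (s' - s) / s0).
  { clear s s' H1 H2; intros s s' H1 H2.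
    assert (E := jac_mu_supergradient s s' ltac:(lra) ltac:(lra)).
    assert (D := defect_nonneg s' (ground s) ltac:(lra) (ground_finite_energy s ltac:(lra))).
    assert (N := norm2_ground_ge1 s ltac:(lra)).
    assert (B := kinetic_ground_bound s ltac:(lra)).
    assert (K := kinetic_nonneg (ground s) (ground_finite_energy s ltac:(lra))).
    apply Rmult_le_reg_r with (norm2 (ground s)); [lra|].
    apply Rle_trans with (Rabs (s' - s) * kinetic (ground s)).
    - assert (X := Rle_abs (s' - s)). apply Rmult_le_compat_r with (r := kinetic (ground s)) in X; lra.
    - unfold Rdiv; rewrite Rmult_assoc; apply Rmult_le_compat_l; [apply Rabs_pos|].
      apply Rmult_le_reg_l with s0; [assumption|].
      rewrite <- Rmult_assoc, Rinv_r, Rmult_1_l by lra.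
      apply Rmult_le_compat_r with (r := kinetic (ground s)) in H1; lra. }
  assert (G1 := G s s' H1 H2); assert (G2 := G s' s H2 H1).
  rewrite (Rabs_minus_sym s s') in G2. apply Rabs_le; lra.
Qed.

(** * Existence of a multiplier whose ground state has energy [E] *)

Lemma Rmax_continuous_r (a x : R) : continuous (fun t => Rmax a t) x.
Proof.
  apply (continuous_ext (fun t => (a + t + Rabs (a - t)) / 2)).
  - intros t; unfold Rmax; destruct (Rle_dec a t); [rewrite Rabs_left1|rewrite Rabs_pos_eq]; lra.
  - apply (continuous_mult (K := R_AbsRing) (fun t => a + t + Rabs (a - t)) (fun _ => / 2));
      [|apply continuous_const].
    apply (continuous_plus (V := R_NormedModule) (fun t => a + t) (fun t => Rabs (a - t))).
    + apply (continuous_plus (V := R_NormedModule)); [apply continuous_const|apply continuous_id].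
    + apply (continuous_comp (fun t => a - t) Rabs).
      * apply (continuous_minus (V := R_NormedModule)); [apply continuous_const|apply continuous_id].
      * apply continuous_Rabs.
Qed.

Definition energy_gap (E s : R) : R := kinetic (ground s) - E * norm2 (ground s).

(** The nested [Rmax] clamps [t] to [[s0, s1]]: [IVT_gen] takes continuity on the whole line, and
    the dominating series is available only for parameters in a compact interval. *)
Lemma energy_gap_continuous (E s0 s1 x : R) : 0 < s0 -> s0 <= s1 ->
  continuous (fun t => energy_gap E (Rmax s0 (- Rmax (- s1) (- t)))) x.
Proof.
  intros H0 H1; set (cl := fun t => Rmax s0 (- Rmax (- s1) (- t))).
  assert (Hcl : forall t, s0 <= cl t <= s1).
  { intros t; unfold cl; split; [apply Rmax_l|apply Rmax_lub; [assumption|]].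
    assert (X := Rmax_l (- s1) (- t)); lra. }
  assert (Ccl : continuous cl x).
  { unfold cl; apply (continuous_comp (fun t => - Rmax (- s1) (- t)) (Rmax s0)); [|apply Rmax_continuous_r].
    apply (continuous_opp (V := R_NormedModule) (fun t => Rmax (- s1) (- t))).
    apply (continuous_comp (fun t => - t) (Rmax (- s1))); [|apply Rmax_continuous_r].
    apply (continuous_opp (V := R_NormedModule) (fun t => t)), continuous_id. }
  assert (Cmu : continuous (fun t => jac_mu (cl t)) x).
  { apply filterlim_locally; intros [eps Heps].
    assert (He : 0 < eps * s0) by now apply Rmult_lt_0_compat.
    generalize (proj1 (filterlim_locally _ _) Ccl (mkposreal _ He)).
    apply filter_imp; intros y Hy.
    change (Rabs (cl y - cl x) < eps * s0) in Hy.
    change (Rabs (jac_mu (cl y) - jac_mu (cl x)) < eps).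
    apply Rle_lt_trans with (1 := jac_mu_lipschitz s0 _ _ H0 (proj1 (Hcl x)) (proj1 (Hcl y))).
    apply Rmult_lt_reg_r with s0; [assumption|]. unfold Rdiv; rewrite Rmult_assoc, Rinv_l; lra. }
  assert (Cg : forall k, continuous (fun t => ground (cl t) k) x).
  { intros k; unfold ground. now apply (jac_continuous cl (fun t => jac_mu (cl t))). }
  destruct (ground_uniform_bound s0 s1 H0) as [B [HB H]].
  assert (U : forall t k, 0 < ground (cl t) k).
  { intros t k; apply ground_pos; specialize (Hcl t); lra. }
  assert (Csq : forall k, continuous (fun t => ground (cl t) k ^ 2) x).
  { intros k; apply (continuous_ext (fun t => mult (ground (cl t) k) (ground (cl t) k)));
      [intros; unfold mult; simpl; ring|].
    apply (continuous_mult (K := R_AbsRing)); apply Cg. }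
  unfold energy_gap.
  apply (continuous_minus (V := R_NormedModule) (fun t => kinetic (ground (cl t)))
    (fun t => E * norm2 (ground (cl t)))).
  - unfold kinetic.
    apply (zsum_continuous (fun k t => IZR k ^ 2 * ground (cl t) k ^ 2)
       (fun k => (B * B) * (/ 2) ^ Z.abs_nat k)).
    + intros k t; specialize (H (cl t) (Hcl t) k); specialize (U t k).
      assert (0 <= IZR k ^ 2) by apply pow2_ge_0.
      assert (0 <= IZR k ^ 2 * ground (cl t) k) by (apply Rmult_le_pos; lra).
      rewrite Rabs_pos_eq by (apply Rmult_le_pos; apply pow2_ge_0).
      replace (IZR k ^ 2 * ground (cl t) k ^ 2) with (IZR k ^ 2 * ground (cl t) k * ground (cl t) k) by ring.
      nra.
    + apply ex_zsum_scal, ex_zsum_geom.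
    + intros k; apply (continuous_mult (K := R_AbsRing)); [apply continuous_const|apply Csq].
  - apply (continuous_mult (K := R_AbsRing) (fun _ => E)); [apply continuous_const|].
    unfold norm2.
    apply (zsum_continuous (fun k t => ground (cl t) k ^ 2)
       (fun k => (B * B) * (/ 2) ^ Z.abs_nat k)).
    + intros k t; specialize (H (cl t) (Hcl t) k); specialize (U t k).
      rewrite Rabs_pos_eq by apply pow2_ge_0. simpl. nra.
    + apply ex_zsum_scal, ex_zsum_geom.
    + exact Csq.
Qed.

(* The supersolution [2 N^2 - min(n,N)^2] at [s = 1/(2EN^2)]. *)
Lemma jac_mu_small_s (E : R) : 0 < E -> exists s, 0 < s /\ jac_mu s <= 1 - s * E.
Proof.
  (* The size of [M] gives [M >= 2 E], used at the corner of the profile, and [M^2 >= E], used on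
     its plateau. *)
  intros HE. destruct (nfloor_ex (3 * E + 1) ltac:(lra)) as [N [_ HN]].
  set (M := S N). assert (HM : 3 * E + 1 < INR M) by (unfold M; rewrite S_INR; exact HN).
  clearbody M; clear N HN.
  (* This [s] turns the supersolution inequality at [0] into an equality. *)
  set (s := / (2 * E * INR M ^ 2)).
  assert (P0 : 0 < INR M ^ 2) by (apply pow_lt; lra).
  assert (P1 : 0 < 2 * E * INR M ^ 2) by (repeat apply Rmult_lt_0_compat; lra).
  assert (Hs : 0 < s) by now apply Rinv_0_lt_compat.
  assert (SE : s * E * (2 * INR M ^ 2) = 1) by (unfold s; field; lra).
  exists s; split; [assumption|].
  apply jac_mu_le; [lra|].
  set (v := fun n => if Nat.leb n M then INR n ^ 2 else INR M ^ 2).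
  assert (Hv : forall n, 0 <= v n <= INR M ^ 2).
  { intros n; unfold v; destruct (Nat.leb_spec n M) as [Hn|Hn]; [|lra].
    split; [apply pow2_ge_0|]. apply pow_incr; split; [apply pos_INR|now apply le_INR]. }
  apply (jac_pos_supersolution _ _ (fun n => 2 * INR M ^ 2 - v n)).
  - intros n; specialize (Hv n); lra.
  - assert (V0 : v O = 0) by (unfold v; simpl; ring).
    assert (V1 : v 1%nat = 1).
    { unfold v; destruct (Nat.leb_spec 1 M) as [Hn|Hn]; [simpl; ring|].
      replace M with O in HM by lia; simpl in HM; lra. }
    rewrite V0, V1. lra.
  (* On the parabola the second difference is [- 2], which covers the loss [2 s E w <= 2]. At the
     corner it is [2 M - 1], paid for by the term [s M^2]; on the plateau it is [0] and
     [E <= (n + 1)^2] suffices. *)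
  - intros n. destruct (Nat.lt_trichotomy (S n) M) as [Hn|[Hn|Hn]].
    + unfold v; destruct (Nat.leb_spec n M), (Nat.leb_spec (S n) M), (Nat.leb_spec (S (S n)) M); try lia.
      rewrite !S_INR.
      assert (Q : (INR n + 1) ^ 2 <= INR M ^ 2).
      { rewrite <- S_INR; apply pow_incr; split; [apply pos_INR|apply le_INR; lia]. }
      assert (N0 := pos_INR n).
      assert (0 <= s * (INR n + 1) ^ 2 * (2 * INR M ^ 2 - (INR n + 1) ^ 2)).
      { repeat apply Rmult_le_pos; nra. }
      assert (0 <= s * E * (INR n + 1) ^ 2) by (repeat apply Rmult_le_pos; nra).
      nra.
    + unfold v; destruct (Nat.leb_spec n M), (Nat.leb_spec (S n) M), (Nat.leb_spec (S (S n)) M); try lia.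
      rewrite Hn. replace (INR n) with (INR M - 1) by (rewrite <- Hn, S_INR; ring).
      assert (T : 2 * INR M - 1 <= (INR M ^ 2 - E) / E).
      { apply Rmult_le_reg_r with E; [assumption|]. unfold Rdiv; rewrite Rmult_assoc, Rinv_l by lra. nra. }
      assert (T2 : (INR M ^ 2 - E) / E = 2 * s * (INR M ^ 2 - E) * INR M ^ 2).
      { unfold s; field; split; lra. }
      nra.
    + unfold v; destruct (Nat.leb_spec (S n) M), (Nat.leb_spec (S (S n)) M); try lia.
      destruct (Nat.leb_spec n M).
      2:{ assert (T : s * E <= s * INR (S n) ^ 2).
        { apply Rmult_le_compat_l; [lra|].
          assert (INR M <= INR (S n)) by (apply le_INR; lia). nra. }
        apply Rmult_le_compat_r with (r := INR M ^ 2) in T; nra. }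
      replace n with M by lia.
      assert (T : s * E <= s * INR (S M) ^ 2).
      { apply Rmult_le_compat_l; [lra|]. rewrite S_INR. nra. }
      apply Rmult_le_compat_r with (r := INR M ^ 2) in T; nra.
Qed.

(** If [jac_mu s] were at most [1 - d], the positive solution would fall by at least [d] at each of
    more than [1 / d] steps and become negative. *)
Lemma jac_mu_near_1 (d : R) : 0 < d -> exists s0, 0 < s0 /\
  forall s, 0 < s <= s0 -> 1 - d < jac_mu s.
Proof.
  intros Hd. destruct (nfloor_ex (/ d)) as [N [_ HN]].
  { apply Rlt_le, Rinv_0_lt_compat, Hd. }
  set (M := S N). assert (HM : 1 < d * INR M).
  { unfold M; rewrite S_INR. apply Rmult_lt_compat_l with (r := d) in HN; [|assumption].
    rewrite Rinv_r in HN; lra. }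
  clearbody M; clear N HN.
  assert (PM : 0 < INR M).
  { destruct (pos_INR M) as [H|H]; [assumption|]. rewrite <- H in HM; lra. }
  (* For [s <= s0] and [n <= M] one has [s n^2 <= d / 2], so the recursion coefficient is at most
     [2] and the solution stays concave up to [M]. *)
  set (s0 := d / (2 * INR M ^ 2)).
  assert (P0 : 0 < INR M ^ 2) by now apply pow_lt.
  exists s0; split; [apply Rdiv_lt_0_compat; lra|].
  intros s Hs; destruct (Rlt_dec (1 - d) (jac_mu s)) as [H|H]; [assumption|exfalso].
  assert (P := jac_mu_pos s ltac:(lra)).
  assert (G : forall n, (n <= M)%nat -> jac s (jac_mu s) n <= 1 - d * INR n
     /\ jac s (jac_mu s) (S n) - jac s (jac_mu s) n <= - d).
  { induction n as [|n IH]; intros Hn.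
    - rewrite jac_0, jac_1; simpl; lra.
    - destruct (IH ltac:(lia)) as [I1 I2].
      split; [rewrite S_INR; lra|].
      rewrite jac_SS. specialize (P (S n)).
      assert (T : s * INR (S n) ^ 2 <= d / 2).
      { apply Rle_trans with (s0 * INR M ^ 2).
        - apply Rmult_le_compat; [lra|apply pow2_ge_0|lra|].
          apply pow_incr; split; [apply pos_INR|now apply le_INR].
        - apply Req_le; unfold s0; field; lra. }
      assert ((2 * (s * INR (S n) ^ 2 + jac_mu s) - 2) * jac s (jac_mu s) (S n) <= 0); [|lra].
      apply Ropp_le_cancel; rewrite Ropp_0, Ropp_mult_distr_l; apply Rmult_le_pos; lra. }
  destruct (G M (le_n M)) as [G1 _]. specialize (P M). lra.
Qed.

(** If the energy stayed below [E] on [(0, / E]], it would do so everywhere, and [jac_mu] would drop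
    at rate at most [E]. That contradicts its being near [1] for small [s] and at most [1 - 2 s' E]
    at some [s']. At [s = / E] the energy is below [E], and the intermediate value theorem
    applies. *)
Lemma energy_gap_root (E : R) : 0 < E -> exists s, 0 < s /\ energy_gap E s = 0.
Proof.
  intros HE.
  assert (L : exists s0, 0 < s0 <= / E /\ 0 <= energy_gap E s0).
  { destruct (classic (exists s0, 0 < s0 <= / E /\ 0 <= energy_gap E s0)) as [H|H];
      [assumption|exfalso].
    assert (G : forall s, 0 < s -> kinetic (ground s) <= E * norm2 (ground s)).
    { intros s Hs. destruct (Rle_dec s (/ E)) as [Hle|Hgt].
      - destruct (Rle_dec 0 (energy_gap E s)) as [X|X]; [exfalso; apply H; exists s; tauto|].
        unfold energy_gap in X; lra.
      - assert (B := kinetic_ground_bound s Hs). assert (K := kinetic_nonneg _ (ground_finite_energy s Hs)).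
        assert (1 <= E * s).
        { apply Rmult_le_reg_l with (/ E); [now apply Rinv_0_lt_compat|].
          rewrite <- Rmult_assoc, Rinv_l; lra. }
        nra. }
    (* The factor [2] leaves a drop of more than [s' E] although [jac_mu s] is only known to exceed
       [1 - s' E]. *)
    destruct (jac_mu_small_s (2 * E) ltac:(lra)) as [s' [Hs' M']].
    set (d := s' * E). assert (Hd : 0 < d) by now apply Rmult_lt_0_compat.
    destruct (jac_mu_near_1 d Hd) as [s0 [Hs0 M0]].
    set (s := Rmin s0 s').
    assert (S1 : 0 < s) by (apply Rmin_glb_lt; assumption).
    assert (S2 := Rmin_l s0 s'); assert (S3 := Rmin_r s0 s'); fold s in S2, S3.
    specialize (M0 s ltac:(lra)).
    assert (E1 := jac_mu_supergradient s s' S1 Hs').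
    assert (D := defect_nonneg s' (ground s) Hs' (ground_finite_energy s S1)).
    assert (N := norm2_ground_ge1 s S1).
    assert (X : (jac_mu s - jac_mu s') * norm2 (ground s) <= (s' - s) * E * norm2 (ground s)).
    { specialize (G s S1). apply Rmult_le_compat_l with (r := s' - s) in G; lra. }
    apply Rmult_le_reg_r in X; [|lra].
    assert (0 < s * E) by now apply Rmult_lt_0_compat. unfold d in *. lra. }
  destruct L as [s0 [[Hs0 Hs1] HF0]].
  set (s1 := / E) in *.
  assert (HF1 : energy_gap E s1 <= 0).
  { unfold energy_gap; assert (B := kinetic_ground_bound s1 ltac:(lra)).
    apply Rmult_lt_compat_l with (r := E) in B; [|assumption].
    unfold s1 in B at 1. rewrite <- Rmult_assoc, Rinv_r in B; lra. }
  set (F := fun t => energy_gap E (Rmax s0 (- Rmax (- s1) (- t)))).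
  destruct (IVT_gen F s0 s1 0) as [t [_ Ht]].
  - intros x; apply continuity_pt_filterlim. now apply energy_gap_continuous.
  - assert (F0 : F s0 = energy_gap E s0).
    { unfold F; rewrite (Rmax_right (- s1) (- s0)), Rmax_left by lra; reflexivity. }
    assert (F1 : F s1 = energy_gap E s1).
    { unfold F; rewrite (Rmax_left (- s1) (- s1)), Ropp_involutive, Rmax_right by lra; reflexivity. }
    rewrite F0, F1, Rmin_right, Rmax_left; lra.
  - exists (Rmax s0 (- Rmax (- s1) (- t))); split; [|exact Ht].
    apply Rlt_le_trans with (1 := Hs0), Rmax_l.
Qed.

(** * Fourier series with summable coefficients *)

Lemma Cmod_sqr (z : C) : Cmod z ^ 2 = Re z ^ 2 + Im z ^ 2.
Proof.
  unfold Cmod, Re, Im; rewrite pow2_sqrt; [reflexivity|].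
  apply Rplus_le_le_0_compat; apply pow2_ge_0.
Qed.

Lemma Rabs_Re_le (z : C) : Rabs (Re z) <= Cmod z.
Proof. apply Rle_trans with (2 := Rmax_Cmod z), Rmax_l. Qed.

Lemma Rabs_Im_le (z : C) : Rabs (Im z) <= Cmod z.
Proof. apply Rle_trans with (2 := Rmax_Cmod z), Rmax_r. Qed.

Lemma Rabs_trig_comb_le (z : C) (t : R) :
  Rabs (Re z * cos t - Im z * sin t) <= 2 * Cmod z /\
  Rabs (Re z * sin t + Im z * cos t) <= 2 * Cmod z.
Proof.
  assert (A := Rabs_Re_le z); assert (B := Rabs_Im_le z).
  assert (C := COS_bound t); assert (S := SIN_bound t).
  assert (C' : Rabs (cos t) <= 1) by (apply Rabs_le; lra).
  assert (S' : Rabs (sin t) <= 1) by (apply Rabs_le; lra).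
  assert (P := Rabs_pos (Re z)); assert (Q := Rabs_pos (Im z)).
  assert (P' := Rabs_pos (cos t)); assert (Q' := Rabs_pos (sin t)).
  split.
  - apply Rle_trans with (1 := Rabs_triang _ _); rewrite Rabs_Ropp, !Rabs_mult; nra.
  - apply Rle_trans with (1 := Rabs_triang _ _); rewrite !Rabs_mult; nra.
Qed.

Lemma ex_series_telescope : ex_series (fun n => / ((INR n + 1) * (INR n + 2))).
Proof.
  exists 1.
  assert (S : forall n, sum_n (fun n => / ((INR n + 1) * (INR n + 2))) n = 1 - / (INR n + 2)).
  { induction n as [|n IH].
    - rewrite sum_O; simpl; field.
    - rewrite sum_Sn, IH, !S_INR; unfold plus; simpl. assert (P := pos_INR n). field; lra. }
  change (is_lim_seq (sum_n (fun n => / ((INR n + 1) * (INR n + 2)))) 1).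
  apply (is_lim_seq_ext (fun n => 1 - / (INR n + 2))); [intros; now rewrite S|].
  replace (Finite 1) with (Rbar_minus 1 0) by (simpl; f_equal; ring).
  apply is_lim_seq_minus'; [apply is_lim_seq_const|].
  replace (Finite 0) with (Rbar_inv p_infty) by reflexivity.
  apply is_lim_seq_inv; [|discriminate].
  apply (is_lim_seq_plus _ _ p_infty 2); [apply is_lim_seq_INR|apply is_lim_seq_const|reflexivity].
Qed.

Lemma ex_zsum_inv_sqr : ex_zsum (fun k => / (1 + IZR k ^ 2)).
Proof.
  (* The [4] comes from [(n + 1) (n + 2) <= 4 (1 + n^2)]. A free [m >= n] serves both half-series,
     the negative one starting at [n + 1]. *)
  assert (G : forall n m, INR n <= m -> / (1 + m ^ 2) <= 4 * / ((INR n + 1) * (INR n + 2))).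
  { intros n m Hm. assert (P := pos_INR n).
    apply Rmult_le_reg_r with (1 + m ^ 2); [nra|].
    rewrite Rinv_l by nra.
    apply Rmult_le_reg_r with ((INR n + 1) * (INR n + 2)); [nra|].
    replace (4 * / ((INR n + 1) * (INR n + 2)) * (1 + m ^ 2) * ((INR n + 1) * (INR n + 2)))
      with (4 * (1 + m ^ 2)) by (field; lra).
    assert (INR n ^ 2 <= m ^ 2) by (apply pow_incr; lra).
    assert (X := pow2_ge_0 (INR n - 1)). nra. }
  assert (E : ex_series (fun n => 4 * / ((INR n + 1) * (INR n + 2))))
    by exact (ex_series_scal_l 4 _ ex_series_telescope).
  split; (apply (ex_series_le (K := R_AbsRing) (V := R_CompleteNormedModule)) with (2 := E)); intros n.
  - change (Rabs (/ (1 + IZR (Z.of_nat n) ^ 2)) <= 4 * / ((INR n + 1) * (INR n + 2))).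
    assert (X := pow2_ge_0 (IZR (Z.of_nat n))).
    rewrite Rabs_pos_eq by (apply Rlt_le, Rinv_0_lt_compat; lra).
    apply G; rewrite INR_IZR_INZ; lra.
  - change (Rabs (/ (1 + IZR (- Z.of_nat (S n)) ^ 2)) <= 4 * / ((INR n + 1) * (INR n + 2))).
    assert (X := pow2_ge_0 (IZR (- Z.of_nat (S n)))).
    rewrite Rabs_pos_eq by (apply Rlt_le, Rinv_0_lt_compat; lra).
    rewrite opp_IZR, <- INR_IZR_INZ, <- Rsqr_pow2, <- Rsqr_neg, Rsqr_pow2.
    apply G; rewrite S_INR; lra.
Qed.

(** With [x = 1 + k^2] one has [|c| <= x |c|^2 + 1 / x]. Thus the Fourier series of a finite-energy
    state converges absolutely and uniformly. *)
Lemma ex_zsum_Cmod (c : Z -> C) :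
  ex_zsum (fun k => Cmod (c k) ^ 2) -> ex_zsum (fun k => IZR k ^ 2 * Cmod (c k) ^ 2) ->
  ex_zsum (fun k => Cmod (c k)).
Proof.
  intros H1 H2.
  apply (ex_zsum_le _ (fun k => Cmod (c k) ^ 2 + IZR k ^ 2 * Cmod (c k) ^ 2 + / (1 + IZR k ^ 2))).
  - intros k; rewrite Rabs_pos_eq by apply Cmod_ge_0.
    assert (P := pow2_ge_0 (IZR k)). assert (Q := Cmod_ge_0 (c k)).
    set (x := 1 + IZR k ^ 2).
    replace (Cmod (c k) ^ 2 + IZR k ^ 2 * Cmod (c k) ^ 2) with (x * Cmod (c k) ^ 2) by (unfold x; ring).
    assert (Hx : 0 < x) by (unfold x; lra). assert (Hi := Rinv_0_lt_compat _ Hx).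
    apply Rmult_le_reg_l with x; [assumption|].
    rewrite Rmult_plus_distr_l, Rinv_r by lra.
    assert (X := pow2_ge_0 (x * Cmod (c k) - 1)). nra.
  - apply ex_zsum_plus; [now apply ex_zsum_plus|apply ex_zsum_inv_sqr].
Qed.

Lemma is_derive_sin_lin (m x : R) : is_derive (fun t => sin (m * t)) x (m * cos (m * x)).
Proof. auto_derive; [exact I|ring]. Qed.

Lemma is_derive_cos_lin (m x : R) : is_derive (fun t => cos (m * t)) x (- m * sin (m * x)).
Proof. auto_derive; [exact I|ring]. Qed.

Lemma continuous_sin_lin (m x : R) : continuous (fun t => sin (m * t)) x.
Proof. apply (ex_derive_continuous (V := R_NormedModule)). eexists; apply is_derive_sin_lin. Qed.

Lemma continuous_cos_lin (m x : R) : continuous (fun t => cos (m * t)) x.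
Proof. apply (ex_derive_continuous (V := R_NormedModule)). eexists; apply is_derive_cos_lin. Qed.

Lemma sin_IZR_PI (m : Z) : sin (IZR m * PI) = 0.
Proof. apply sin_eq_0_1; now exists m. Qed.

Lemma RInt_cos_int (m : Z) :
  RInt (fun t => cos (IZR m * t)) (- PI) PI = if Z.eq_dec m 0 then 2 * PI else 0.
Proof.
  destruct (Z.eq_dec m 0) as [->|Hm].
  - rewrite (RInt_ext _ (fun _ => 1)) by (intros; now rewrite Rmult_0_l, cos_0).
    rewrite RInt_const; unfold scal; simpl; unfold mult; simpl; ring.
  - assert (Hm' : IZR m <> 0) by now apply not_0_IZR.
    apply is_RInt_unique.
    replace 0 with (minus (/ IZR m * sin (IZR m * PI)) (/ IZR m * sin (IZR m * - PI))).
    + apply (is_RInt_derive (V := R_CompleteNormedModule) (fun t => / IZR m * sin (IZR m * t))).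
      * intros x _; auto_derive; [exact I|field; assumption].
      * intros x _; apply continuous_cos_lin.
    + replace (IZR m * - PI) with (- (IZR m * PI)) by ring. rewrite sin_neg, sin_IZR_PI.
      unfold minus, plus, opp; simpl; ring.
Qed.

Lemma RInt_sin_int (m : Z) : RInt (fun t => sin (IZR m * t)) (- PI) PI = 0.
Proof.
  destruct (Z.eq_dec m 0) as [->|Hm].
  - rewrite (RInt_ext _ (fun _ => 0)) by (intros; now rewrite Rmult_0_l, sin_0).
    rewrite RInt_const; unfold scal; simpl; unfold mult; simpl; ring.
  - assert (Hm' : IZR m <> 0) by now apply not_0_IZR.
    apply is_RInt_unique.
    replace 0 with (minus (- / IZR m * cos (IZR m * PI)) (- / IZR m * cos (IZR m * - PI))).
    + apply (is_RInt_derive (V := R_CompleteNormedModule) (fun t => - / IZR m * cos (IZR m * t))).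
      * intros x _; auto_derive; [exact I|field; assumption].
      * intros x _; apply continuous_sin_lin.
    + replace (IZR m * - PI) with (- (IZR m * PI)) by ring. rewrite cos_neg.
      unfold minus, plus, opp; simpl; ring.
Qed.

Lemma Re_fourier_fun (c : Z -> C) (t : R) :
  Re (fourier_fun c t) = zsum (fun k => Re (c k) * cos (IZR k * t) - Im (c k) * sin (IZR k * t)).
Proof. reflexivity. Qed.

Lemma Im_fourier_fun (c : Z -> C) (t : R) :
  Im (fourier_fun c t) = zsum (fun k => Re (c k) * sin (IZR k * t) + Im (c k) * cos (IZR k * t)).
Proof. reflexivity. Qed.

Lemma ex_zsum_trig_comb (c : Z -> C) (f : Z -> R) : ex_zsum (fun k => Cmod (c k)) ->
  ex_zsum (fun k => Re (c k) * cos (f k) - Im (c k) * sin (f k)) /\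
  ex_zsum (fun k => Re (c k) * sin (f k) + Im (c k) * cos (f k)).
Proof.
  intros H; split; (apply (ex_zsum_le _ (fun k => 2 * Cmod (c k)));
    [intros k; now apply Rabs_trig_comb_le|now apply ex_zsum_scal]).
Qed.

Lemma continuous_trig_comb (a b m x : R) :
  continuous (fun t => a * cos (m * t) - b * sin (m * t)) x /\
  continuous (fun t => a * sin (m * t) + b * cos (m * t)) x.
Proof.
  split; apply (ex_derive_continuous (V := R_NormedModule)); auto_derive; exact I.
Qed.

Lemma continuous_fourier_fun (c : Z -> C) (x : R) : ex_zsum (fun k => Cmod (c k)) ->
  continuous (fun t => Re (fourier_fun c t)) x /\ continuous (fun t => Im (fourier_fun c t)) x.
Proof.
  intros H; split.
  - apply (zsum_continuous (fun k t => Re (c k) * cos (IZR k * t) - Im (c k) * sin (IZR k * t))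
      (fun k => 2 * Cmod (c k))).
    + intros k t; exact (proj1 (Rabs_trig_comb_le _ _)).
    + now apply ex_zsum_scal.
    + intros k; exact (proj1 (continuous_trig_comb _ _ _ _)).
  - apply (zsum_continuous (fun k t => Re (c k) * sin (IZR k * t) + Im (c k) * cos (IZR k * t))
      (fun k => 2 * Cmod (c k))).
    + intros k t; exact (proj2 (Rabs_trig_comb_le _ _)).
    + now apply ex_zsum_scal.
    + intros k; exact (proj2 (continuous_trig_comb _ _ _ _)).
Qed.

Lemma fourier_fun_bounded (c : Z -> C) (t : R) : ex_zsum (fun k => Cmod (c k)) ->
  Rabs (Re (fourier_fun c t)) <= 2 * zsum (fun k => Cmod (c k)) /\
  Rabs (Im (fourier_fun c t)) <= 2 * zsum (fun k => Cmod (c k)).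
Proof.
  intros H; destruct (ex_zsum_trig_comb c (fun k => IZR k * t) H) as [E1 E2].
  rewrite Re_fourier_fun, Im_fourier_fun, <- zsum_scal.
  assert (H2 := ex_zsum_scal 2 _ H).
  assert (H2' : ex_zsum (fun k => (-1) * (2 * Cmod (c k)))) by now apply ex_zsum_scal.
  split; apply Rabs_le; split;
    try (apply zsum_le; [|assumption|assumption];
         intros k; destruct (Rabs_trig_comb_le (c k) (IZR k * t)) as [A B];
         apply Rabs_le_between in A; apply Rabs_le_between in B; lra);
    (replace (- zsum (fun k => 2 * Cmod (c k))) with ((-1) * zsum (fun k => 2 * Cmod (c k))) by ring);
    rewrite <- zsum_scal; (apply zsum_le; [|assumption|assumption]);
    intros k; destruct (Rabs_trig_comb_le (c k) (IZR k * t)) as [A B];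
    apply Rabs_le_between in A; apply Rabs_le_between in B; lra.
Qed.

(* The integrands are the real and imaginary parts of [fourier_fun c t * cexpi (- j t)]. *)
Lemma fourier_coeff (c : Z -> C) (j : Z) : ex_zsum (fun k => Cmod (c k)) ->
  RInt (fun t => Re (fourier_fun c t) * cos (IZR j * t) + Im (fourier_fun c t) * sin (IZR j * t))
    (- PI) PI = 2 * PI * Re (c j) /\
  RInt (fun t => Im (fourier_fun c t) * cos (IZR j * t) - Re (fourier_fun c t) * sin (IZR j * t))
    (- PI) PI = 2 * PI * Im (c j).
Proof.
  intros H; assert (H2 := ex_zsum_scal 2 _ H).
  assert (XC : forall m, ex_RInt (fun t => cos (m * t)) (- PI) PI).
  { intros m; apply (ex_RInt_continuous (V := R_CompleteNormedModule)); intros; apply continuous_cos_lin. }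
  assert (XS : forall m, ex_RInt (fun t => sin (m * t)) (- PI) PI).
  { intros m; apply (ex_RInt_continuous (V := R_CompleteNormedModule)); intros; apply continuous_sin_lin. }
  split.
  - rewrite (RInt_ext _ (fun t => zsum (fun k =>
      Re (c k) * cos (IZR (k - j) * t) - Im (c k) * sin (IZR (k - j) * t)))).
    2:{ intros t _; rewrite Re_fourier_fun, Im_fourier_fun.
      destruct (ex_zsum_trig_comb c (fun k => IZR k * t) H) as [E1 E2].
      rewrite Rmult_comm, <- zsum_scal, (Rmult_comm _ (sin _)), <- zsum_scal, <- zsum_plus
        by now apply ex_zsum_scal.
      apply zsum_ext; intros k; rewrite minus_IZR, Rmult_minus_distr_r, cos_minus, sin_minus; ring. }
    rewrite (RInt_zsum (fun k t => Re (c k) * cos (IZR (k - j) * t) - Im (c k) * sin (IZR (k - j) * t))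
      (fun k => 2 * Cmod (c k))); [|intros; exact (proj1 (Rabs_trig_comb_le _ _))|assumption|intros; exact (proj1 (continuous_trig_comb _ _ _ _))].
    assert (V : forall k, RInt (fun t => Re (c k) * cos (IZR (k - j) * t) - Im (c k) * sin (IZR (k - j) * t))
       (- PI) PI = if Z.eq_dec (k - j) 0 then 2 * PI * Re (c k) else 0).
    { intros k.
      rewrite (RInt_minus (V := R_CompleteNormedModule) (fun t => Re (c k) * cos (IZR (k - j) * t))
        (fun t => Im (c k) * sin (IZR (k - j) * t)))
        by (apply (ex_RInt_scal (V := R_NormedModule)); auto).
      rewrite (RInt_scal (V := R_CompleteNormedModule) (fun t => cos (IZR (k - j) * t))) by auto.
      rewrite (RInt_scal (V := R_CompleteNormedModule) (fun t => sin (IZR (k - j) * t))) by auto.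
      rewrite RInt_cos_int, RInt_sin_int; unfold minus, plus, opp, scal; simpl; unfold mult; simpl.
      destruct (Z.eq_dec (k - j) 0); ring. }
    rewrite (zsum_ext _ _ V), (zsum_single _ j).
    + destruct (Z.eq_dec (j - j) 0); [reflexivity|lia].
    + intros k Hk; destruct (Z.eq_dec (k - j) 0); [lia|reflexivity].
  - rewrite (RInt_ext _ (fun t => zsum (fun k =>
      Re (c k) * sin (IZR (k - j) * t) + Im (c k) * cos (IZR (k - j) * t)))).
    2:{ intros t _; rewrite Re_fourier_fun, Im_fourier_fun.
      destruct (ex_zsum_trig_comb c (fun k => IZR k * t) H) as [E1 E2].
      rewrite Rmult_comm, <- zsum_scal, (Rmult_comm _ (sin _)), <- zsum_scal, <- zsum_minus
        by now apply ex_zsum_scal.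
      apply zsum_ext; intros k; rewrite minus_IZR, Rmult_minus_distr_r, cos_minus, sin_minus; ring. }
    rewrite (RInt_zsum (fun k t => Re (c k) * sin (IZR (k - j) * t) + Im (c k) * cos (IZR (k - j) * t))
      (fun k => 2 * Cmod (c k))); [|intros; exact (proj2 (Rabs_trig_comb_le _ _))|assumption|intros; exact (proj2 (continuous_trig_comb _ _ _ _))].
    assert (V : forall k, RInt (fun t => Re (c k) * sin (IZR (k - j) * t) + Im (c k) * cos (IZR (k - j) * t))
       (- PI) PI = if Z.eq_dec (k - j) 0 then 2 * PI * Im (c k) else 0).
    { intros k.
      rewrite (RInt_plus (V := R_CompleteNormedModule) (fun t => Re (c k) * sin (IZR (k - j) * t))
        (fun t => Im (c k) * cos (IZR (k - j) * t)))
        by (apply (ex_RInt_scal (V := R_NormedModule)); auto).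
      rewrite (RInt_scal (V := R_CompleteNormedModule) (fun t => cos (IZR (k - j) * t))) by auto.
      rewrite (RInt_scal (V := R_CompleteNormedModule) (fun t => sin (IZR (k - j) * t))) by auto.
      rewrite RInt_cos_int, RInt_sin_int; unfold minus, plus, opp, scal; simpl; unfold mult; simpl.
      destruct (Z.eq_dec (k - j) 0); ring. }
    rewrite (zsum_ext _ _ V), (zsum_single _ j).
    + destruct (Z.eq_dec (j - j) 0); [reflexivity|lia].
    + intros k Hk; destruct (Z.eq_dec (k - j) 0); [lia|reflexivity].
Qed.

Lemma fourier_fun_inj (c d : Z -> C) :
  ex_zsum (fun k => Cmod (c k)) -> ex_zsum (fun k => Cmod (d k)) ->
  (forall t, fourier_fun c t = fourier_fun d t) -> forall k, c k = d k.
Proof.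
  intros Hc Hd H k.
  destruct (fourier_coeff c k Hc) as [C1 C2]; destruct (fourier_coeff d k Hd) as [D1 D2].
  assert (P := PI_RGT_0).
  assert (E1 : 2 * PI * Re (c k) = 2 * PI * Re (d k)).
  { rewrite <- C1, <- D1; apply RInt_ext; intros; now rewrite H. }
  assert (E2 : 2 * PI * Im (c k) = 2 * PI * Im (d k)).
  { rewrite <- C2, <- D2; apply RInt_ext; intros; now rewrite H. }
  apply Rmult_eq_reg_l in E1; [|lra]. apply Rmult_eq_reg_l in E2; [|lra].
  destruct (c k), (d k); simpl in *; congruence.
Qed.

(** Only one factor of [|f|^2] is expanded. The other is kept and is bounded, so the series stays
    dominated and each integral is a Fourier coefficient. *)
Lemma parseval (c : Z -> C) : ex_zsum (fun k => Cmod (c k)) ->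
  RInt (fun t => Cmod (fourier_fun c t) ^ 2) (- PI) PI = 2 * PI * zsum (fun k => Cmod (c k) ^ 2).
Proof.
  intros H.
  set (fr := fun t : R => Re (fourier_fun c t)); set (fi := fun t : R => Im (fourier_fun c t)).
  set (phi := fun (k : Z) (t : R) => Re (c k) * (fr t * cos (IZR k * t) + fi t * sin (IZR k * t))
     + Im (c k) * (fi t * cos (IZR k * t) - fr t * sin (IZR k * t))).
  assert (Cr : forall x, continuous fr x) by (intros x; exact (proj1 (continuous_fourier_fun c x H))).
  assert (Ci : forall x, continuous fi x) by (intros x; exact (proj2 (continuous_fourier_fun c x H))).
  assert (Mul : forall f g x, continuous f x -> continuous g x -> continuous (fun t : R => f t * g t) x).
  { intros f g x; apply (continuous_mult (K := R_AbsRing)). }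
  assert (C1 : forall k x, continuous (fun t => fr t * cos (IZR k * t) + fi t * sin (IZR k * t)) x).
  { intros k x. apply (continuous_plus (V := R_NormedModule) (fun t => fr t * cos (IZR k * t)));
      apply Mul; auto using continuous_cos_lin, continuous_sin_lin. }
  assert (C2 : forall k x, continuous (fun t => fi t * cos (IZR k * t) - fr t * sin (IZR k * t)) x).
  { intros k x. apply (continuous_minus (V := R_NormedModule) (fun t => fi t * cos (IZR k * t)));
      apply Mul; auto using continuous_cos_lin, continuous_sin_lin. }
  rewrite (RInt_ext _ (fun t => zsum (fun k => phi k t))).
  - set (B := 2 * zsum (fun k => Cmod (c k))).
    rewrite (RInt_zsum phi (fun k => 4 * B * Cmod (c k))).
    + rewrite <- zsum_scal; apply zsum_ext; intros k.
      destruct (fourier_coeff c k H) as [F1 F2]. unfold phi.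
      rewrite (RInt_plus (V := R_CompleteNormedModule)
        (fun t => Re (c k) * (fr t * cos (IZR k * t) + fi t * sin (IZR k * t)))
        (fun t => Im (c k) * (fi t * cos (IZR k * t) - fr t * sin (IZR k * t))))
        by (apply (ex_RInt_scal (V := R_NormedModule));
            apply (ex_RInt_continuous (V := R_CompleteNormedModule)); auto).
      rewrite (RInt_scal (V := R_CompleteNormedModule) (fun t => fr t * cos (IZR k * t) + fi t * sin (IZR k * t)))
        by (apply (ex_RInt_continuous (V := R_CompleteNormedModule)); auto).
      rewrite (RInt_scal (V := R_CompleteNormedModule) (fun t => fi t * cos (IZR k * t) - fr t * sin (IZR k * t)))
        by (apply (ex_RInt_continuous (V := R_CompleteNormedModule)); auto).
      unfold fr, fi; rewrite F1, F2, Cmod_sqr.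
      unfold plus, scal; simpl; unfold mult; simpl; ring.
    + intros k t; unfold phi.
      destruct (fourier_fun_bounded c t H) as [B1 B2]; fold B in B1, B2; fold (fr t) in B1; fold (fi t) in B2.
      destruct (Rabs_trig_comb_le (c k) (IZR k * t)) as [T1 T2].
      replace (_ + _) with (fr t * (Re (c k) * cos (IZR k * t) - Im (c k) * sin (IZR k * t))
        + fi t * (Re (c k) * sin (IZR k * t) + Im (c k) * cos (IZR k * t))) by ring.
      apply Rle_trans with (1 := Rabs_triang _ _). rewrite !Rabs_mult.
      replace (4 * B * Cmod (c k)) with (B * (2 * Cmod (c k)) + B * (2 * Cmod (c k))) by ring.
      apply Rplus_le_compat; apply Rmult_le_compat; try apply Rabs_pos; assumption.
    + now apply ex_zsum_scal.
    + intros k x; unfold phi. apply (continuous_plus (V := R_NormedModule)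
        (fun t => Re (c k) * (fr t * cos (IZR k * t) + fi t * sin (IZR k * t))));
      apply Mul; auto; apply continuous_const.
  - intros t _; rewrite Cmod_sqr; fold (fr t); fold (fi t).
    destruct (ex_zsum_trig_comb c (fun k => IZR k * t) H) as [E1 E2].
    rewrite (zsum_ext _ (fun k => fr t * (Re (c k) * cos (IZR k * t) - Im (c k) * sin (IZR k * t))
        + fi t * (Re (c k) * sin (IZR k * t) + Im (c k) * cos (IZR k * t)))) by (intros; unfold phi; ring).
    rewrite zsum_plus, !zsum_scal by now apply ex_zsum_scal.
    rewrite <- Re_fourier_fun, <- Im_fourier_fun. fold (fr t); fold (fi t).
    match goal with |- ?x = ?y => change (@eq R x y) end; ring.
Qed.

(** * Expectation values of a state in Fourier coefficients *)

Lemma ex_zsum_Re_Im (c : Z -> C) (w : Z -> R) : (forall k, 0 <= w k) ->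
  ex_zsum (fun k => w k * Cmod (c k) ^ 2) ->
  ex_zsum (fun k => w k * Re (c k) ^ 2) /\ ex_zsum (fun k => w k * Im (c k) ^ 2).
Proof.
  intros Hw H; split; apply (ex_zsum_le _ _) with (2 := H); intros k;
    rewrite Cmod_sqr; specialize (Hw k);
    assert (A := pow2_ge_0 (Re (c k))); assert (B := pow2_ge_0 (Im (c k)));
    rewrite Rabs_pos_eq by (apply Rmult_le_pos; lra); nra.
Qed.

Lemma finite_energy_Re_Im (c : Z -> C) :
  ex_zsum (fun k => Cmod (c k) ^ 2) -> ex_zsum (fun k => IZR k ^ 2 * Cmod (c k) ^ 2) ->
  finite_energy (fun k => Re (c k)) /\ finite_energy (fun k => Im (c k)).
Proof.
  intros H1 H2.
  assert (H1' : ex_zsum (fun k => 1 * Cmod (c k) ^ 2))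
    by (apply (ex_zsum_ext (fun k => Cmod (c k) ^ 2)); [intros; ring|assumption]).
  destruct (ex_zsum_Re_Im c (fun _ => 1) (fun _ => Rle_0_1) H1') as [A B].
  destruct (ex_zsum_Re_Im c (fun k => IZR k ^ 2) (fun k => pow2_ge_0 _) H2) as [A' B'].
  split; split; try assumption.
  - apply (ex_zsum_ext (fun k => 1 * Re (c k) ^ 2)); [intros; ring|assumption].
  - apply (ex_zsum_ext (fun k => 1 * Im (c k) ^ 2)); [intros; ring|assumption].
Qed.

Lemma zsum_Cmod_sqr (c : Z -> C) :
  ex_zsum (fun k => Cmod (c k) ^ 2) -> ex_zsum (fun k => IZR k ^ 2 * Cmod (c k) ^ 2) ->
  zsum (fun k => Cmod (c k) ^ 2) = norm2 (fun k => Re (c k)) + norm2 (fun k => Im (c k)) /\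
  zsum (fun k => IZR k ^ 2 * Cmod (c k) ^ 2)
    = kinetic (fun k => Re (c k)) + kinetic (fun k => Im (c k)).
Proof.
  intros H1 H2; destruct (finite_energy_Re_Im c H1 H2) as [[A1 A2] [B1 B2]].
  unfold norm2, kinetic; rewrite <- !zsum_plus by assumption.
  split; apply zsum_ext; intros k; rewrite Cmod_sqr; ring.
Qed.

(* [(1 - cos t) |f|^2 = |(exp (- i t) - 1) f|^2 / 2], and multiplication by [exp (- i t)]
   shifts the Fourier coefficients. *)
Lemma cosQ_exp_fourier_fun (c : Z -> C) :
  ex_zsum (fun k => Cmod (c k) ^ 2) -> ex_zsum (fun k => IZR k ^ 2 * Cmod (c k) ^ 2) ->
  cosQ_exp (fourier_fun c) = hopping (fun k => Re (c k)) + hopping (fun k => Im (c k)).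
Proof.
  intros H1 H2; assert (H := ex_zsum_Cmod c H1 H2).
  destruct (finite_energy_Re_Im c H1 H2) as [[A _] [B _]].
  set (d := fun k => Cminus (c (k + 1)%Z) (c k)).
  assert (Hd : ex_zsum (fun k => Cmod (d k))).
  { apply (ex_zsum_le _ (fun k => Cmod (c (k + 1)%Z) + Cmod (c k))).
    - intros k; rewrite Rabs_pos_eq by apply Cmod_ge_0. unfold d, Cminus.
      rewrite <- (Cmod_opp (c k)). apply Cmod_triangle.
    - apply ex_zsum_plus; [now apply (ex_zsum_shift (fun k => Cmod (c k)))|assumption]. }
  assert (P := PI_RGT_0).
  unfold cosQ_exp.
  rewrite (RInt_ext _ (fun t => scal (/ 2) (Cmod (fourier_fun d t) ^ 2))).
  - rewrite (RInt_scal (V := R_CompleteNormedModule)).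
    + rewrite (parseval d Hd). unfold hopping.
      unfold scal; simpl; unfold mult; simpl.
      rewrite (zsum_ext _ (fun k => (Re (c (k + 1)%Z) - Re (c k)) ^ 2 + (Im (c (k + 1)%Z) - Im (c k)) ^ 2)).
      * rewrite zsum_plus by (first [exact (ex_zsum_hopping _ A)|exact (ex_zsum_hopping _ B)]).
        simpl; field; lra.
      * intros k; change (Cmod (d k) * (Cmod (d k) * 1)) with (Cmod (d k) ^ 2).
        rewrite Cmod_sqr; unfold d, Cminus, Cplus, Copp, Re, Im; simpl; ring.
    + apply (ex_RInt_continuous (V := R_CompleteNormedModule)); intros x _.
      apply (continuous_ext (fun t => plus (mult (Re (fourier_fun d t)) (Re (fourier_fun d t)))
        (mult (Im (fourier_fun d t)) (Im (fourier_fun d t))))).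
      { intros t; rewrite Cmod_sqr; unfold plus, mult; simpl; ring. }
      destruct (continuous_fourier_fun d x Hd) as [D1 D2].
      apply (continuous_plus (V := R_NormedModule)); apply (continuous_mult (K := R_AbsRing)); assumption.
  - intros t _; rewrite !Cmod_sqr.
    destruct (ex_zsum_trig_comb c (fun k => IZR k * t) H) as [E1 E2].
    assert (HC := ex_zsum_shift (fun k => Cmod (c k)) H).
    assert (E1s := ex_zsum_shift _ E1). assert (E2s := ex_zsum_shift _ E2).
    assert (D1 : Re (fourier_fun d t) = (cos t - 1) * Re (fourier_fun c t) + sin t * Im (fourier_fun c t)).
    { rewrite (Re_fourier_fun d), Rmult_minus_distr_r, Rmult_1_l.
      rewrite Re_fourier_fun, Im_fourier_fun.
      rewrite <- (zsum_shift _ E1) at 1. rewrite <- (zsum_shift _ E2).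
      rewrite <- !zsum_scal.
      match goal with |- _ = ?x - ?y + ?z => replace (x - y + z) with (x + z - y) by ring end.
      rewrite <- zsum_plus by now apply ex_zsum_scal.
      rewrite <- zsum_minus by (try assumption; apply ex_zsum_plus; now apply ex_zsum_scal).
      apply zsum_ext; intros k. unfold d, Cminus, Cplus, Copp, Re, Im; simpl.
      replace (IZR (k + 1) * t) with (IZR k * t + t) by (rewrite plus_IZR; ring).
      rewrite cos_plus, sin_plus.
      assert (S := sin2_cos2 t); unfold Rsqr in S.
      set (x := IZR k * t) in *. set (p := fst (c (k + 1)%Z)). set (q := snd (c (k + 1)%Z)).
      transitivity ((p * cos x - q * sin x) * (sin t * sin t + cos t * cos t) - (fst (c k) * cos x - snd (c k) * sin x)).
      - rewrite S; ring.
      - ring. }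
    assert (D2 : Im (fourier_fun d t) = (cos t - 1) * Im (fourier_fun c t) - sin t * Re (fourier_fun c t)).
    { rewrite (Im_fourier_fun d), Rmult_minus_distr_r, Rmult_1_l.
      rewrite Re_fourier_fun, Im_fourier_fun.
      rewrite <- (zsum_shift _ E2) at 1. rewrite <- (zsum_shift _ E1).
      rewrite <- !zsum_scal.
      match goal with |- _ = ?x - ?y - ?z => replace (x - y - z) with (x - z - y) by ring end.
      rewrite <- zsum_minus by now apply ex_zsum_scal.
      rewrite <- zsum_minus by (try assumption; apply ex_zsum_minus; now apply ex_zsum_scal).
      apply zsum_ext; intros k. unfold d, Cminus, Cplus, Copp, Re, Im; simpl.
      replace (IZR (k + 1) * t) with (IZR k * t + t) by (rewrite plus_IZR; ring).
      rewrite cos_plus, sin_plus.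
      assert (S := sin2_cos2 t); unfold Rsqr in S.
      set (x := IZR k * t) in *. set (p := fst (c (k + 1)%Z)). set (q := snd (c (k + 1)%Z)).
      transitivity ((p * sin x + q * cos x) * (sin t * sin t + cos t * cos t) - (fst (c k) * sin x + snd (c k) * cos x)).
      - rewrite S; ring.
      - ring. }
    rewrite D1, D2. assert (S := sin2_cos2 t); unfold Rsqr in S.
    generalize (Re (fourier_fun c t)) (Im (fourier_fun c t)); intros x y.
    change ((1 - cos t) * (x ^ 2 + y ^ 2)
      = / 2 * (((cos t - 1) * x + sin t * y) ^ 2 + ((cos t - 1) * y - sin t * x) ^ 2)).
    transitivity (/ 2 * ((x * x + y * y) * ((sin t * sin t + cos t * cos t) - 2 * cos t + 1))).
    + rewrite S; field.
    + ring.
Qed.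

Lemma Finv_fourier_fun (phi : Z -> C) (t : R) : ex_zsum (fun k => Cmod (phi k)) ->
  Finv phi t = fourier_fun (fun k => phi (- k)%Z) t.
Proof.
  intros H. unfold Finv, fourier_fun, zsumC.
  destruct (ex_zsum_trig_comb phi (fun k => - (IZR k * t)) H) as [E1 E2].
  assert (X : forall k : Z, - (IZR (- k) * t) = IZR k * t) by (intros; rewrite opp_IZR; ring).
  f_equal.
  - symmetry; etransitivity; [|exact (zsum_opp _ E1)].
    apply zsum_ext; intros k; rewrite X; reflexivity.
  - symmetry; etransitivity; [|exact (zsum_opp _ E2)].
    apply zsum_ext; intros k; rewrite X; reflexivity.
Qed.

(** The sines cancel between [k] and [- k], so the series is real up to the factor [w]. *)
Lemma fourier_fun_real_even (w : C) (u : Z -> R) (t : R) :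
  ex_zsum (fun k => u k * cos (IZR k * t)) -> ex_zsum (fun k => u k * sin (IZR k * t)) ->
  (forall k, u (- k)%Z = u k) ->
  fourier_fun (fun k => Cmult w (RtoC (u k))) t = Cmult w (RtoC (zsum (fun k => u k * cos (IZR k * t)))).
Proof.
  intros Ec Es Hu.
  assert (S : zsum (fun k => u k * sin (IZR k * t)) = 0).
  { assert (Z := zsum_opp _ Es).
    rewrite (zsum_ext _ (fun k => (-1) * (u k * sin (IZR k * t)))) in Z.
    - rewrite zsum_scal in Z; lra.
    - intros k; rewrite Hu, opp_IZR, Ropp_mult_distr_l_reverse, sin_neg; ring. }
  assert (G : forall a b, zsum (fun k => a * (u k * cos (IZR k * t)) + b * (u k * sin (IZR k * t)))
    = a * zsum (fun k => u k * cos (IZR k * t))).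
  { intros a b; rewrite zsum_plus, !zsum_scal, S by now apply ex_zsum_scal. ring. }
  unfold fourier_fun, zsumC, Cmult, RtoC, Re, Im; simpl. f_equal.
  - transitivity (fst w * zsum (fun k => u k * cos (IZR k * t))); [|ring].
    rewrite <- (G (fst w) (- snd w)); apply zsum_ext; intros; ring.
  - transitivity (snd w * zsum (fun k => u k * cos (IZR k * t))); [|ring].
    rewrite <- (G (snd w) (fst w)); apply zsum_ext; intros; ring.
Qed.

(** * Mathieu's equation *)

Ltac Req := match goal with |- ?a = ?b => change (@eq R a b) end.

Lemma continuous_Rmult (f g : R -> R) (x : R) :
  continuous f x -> continuous g x -> continuous (fun t => f t * g t) x.
Proof. apply (continuous_mult (K := R_AbsRing)). Qed.

Lemma ex_RInt_cont (f : R -> R) (a b : R) : (forall x, continuous f x) -> ex_RInt f a b.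
Proof. intros H; apply (ex_RInt_continuous (V := R_CompleteNormedModule)); auto. Qed.

Lemma RInt_lin (f g : R -> R) (u v a b : R) :
  (forall x, continuous f x) -> (forall x, continuous g x) ->
  RInt (fun x => u * f x + v * g x) a b = u * RInt f a b + v * RInt g a b.
Proof.
  intros Hf Hg.
  rewrite (RInt_plus (V := R_CompleteNormedModule) (fun x => u * f x) (fun x => v * g x)).
  - rewrite (RInt_scal (V := R_CompleteNormedModule) f), (RInt_scal (V := R_CompleteNormedModule) g)
      by now apply ex_RInt_cont.
    reflexivity.
  - apply ex_RInt_cont; intros x; apply continuous_Rmult; [apply continuous_const|auto].
  - apply ex_RInt_cont; intros x; apply continuous_Rmult; [apply continuous_const|auto].
Qed.

Lemma continuous_bounded (f : R -> R) (a b : R) : a <= b -> (forall x, continuous f x) ->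
  exists M, forall x, a <= x <= b -> Rabs (f x) <= M.
Proof.
  intros Hab Hf.
  destruct (continuity_ab_maj (fun x => Rabs (f x)) a b Hab) as [m [Hm _]].
  - intros x _; apply continuity_pt_filterlim.
    apply (continuous_comp f Rabs); [apply Hf|apply continuous_Rabs].
  - now exists (Rabs (f m)).
Qed.

(** * Cosine moments determine an even continuous function of period [PI] *)

Lemma RInt_period (g : R -> R) (a b : R) : (forall x, continuous g x) ->
  (forall x, g (x + PI) = g x) -> RInt g a (a + PI) = RInt g b (b + PI).
Proof.
  intros Hc Hp.
  assert (Ex : forall u v, ex_RInt g u v) by (intros; now apply ex_RInt_cont).
  assert (S : RInt g (b + PI) (a + PI) = RInt g b a).
  { assert (L := RInt_comp_lin (V := R_CompleteNormedModule) g 1 PI b a (Ex _ _)).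
    rewrite !Rmult_1_l in L; rewrite <- L. apply RInt_ext; intros x _.
    rewrite (Rmult_1_l x), Hp; exact (Rmult_1_l (g x)). }
  rewrite <- (RInt_Chasles g a b (a + PI)), <- (RInt_Chasles g b (b + PI) (a + PI)) by apply Ex.
  rewrite S, <- (opp_RInt_swap g a b) by apply Ex.
  unfold plus, opp; simpl; Req; ring.
Qed.

Lemma RInt_odd (g : R -> R) (a : R) : (forall x, continuous g x) ->
  (forall x, g (- x) = - g x) -> RInt g (- a) a = 0.
Proof.
  intros Hc Ho.
  assert (Ex : forall u v, ex_RInt g u v) by (intros; now apply ex_RInt_cont).
  assert (L := RInt_comp_lin (V := R_CompleteNormedModule) g (-1) 0 (- a) a (Ex _ _)).
  replace (-1 * - a + 0) with a in L by ring. replace (-1 * a + 0) with (- a) in L by ring.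
  rewrite (RInt_ext _ g) in L.
  - rewrite <- (opp_RInt_swap g (- a) a) in L by apply Ex.
    unfold opp in L; simpl in L; lra.
  - intros x _. replace (-1 * x + 0) with (- x) by ring. rewrite Ho.
    unfold scal; simpl; unfold mult; simpl; Req; ring.
Qed.

(** The difference of the two integrands is the derivative of [sin x cos^{2n+1} x], which vanishes
    at both ends. The recursion measures how fast the kernels concentrate at [0]. *)
Lemma wallis_recursion (n : nat) :
  (2 * INR n + 2) * RInt (fun x => (cos x ^ 2) ^ S n) (- (PI / 2)) (PI / 2)
  = (2 * INR n + 1) * RInt (fun x => (cos x ^ 2) ^ n) (- (PI / 2)) (PI / 2).
Proof.
  assert (C : forall m x, continuous (fun x => (cos x ^ 2) ^ m) x).
  { intros m x; apply (ex_derive_continuous (V := R_NormedModule)); auto_derive; exact I. }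
  assert (H : is_RInt (fun x => (2 * INR n + 2) * (cos x ^ 2) ^ S n + - (2 * INR n + 1) * (cos x ^ 2) ^ n)
    (- (PI / 2)) (PI / 2)
    (minus (sin (PI / 2) * (cos (PI / 2) * (cos (PI / 2) ^ 2) ^ n))
       (sin (- (PI / 2)) * (cos (- (PI / 2)) * (cos (- (PI / 2)) ^ 2) ^ n)))).
  { apply (is_RInt_derive (V := R_CompleteNormedModule) (fun x => sin x * (cos x * (cos x ^ 2) ^ n))).
    - intros x _.
      assert (D : is_derive (fun x => (cos x ^ 2) ^ n) x (INR n * (- 2 * sin x * cos x) * (cos x ^ 2) ^ pred n)).
      { apply (is_derive_ext (fun x => (cos x * cos x) ^ n)); [intros; f_equal; ring|].
        replace (cos x ^ 2) with (cos x * cos x) by ring.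
        apply (is_derive_pow (fun x => cos x * cos x)). auto_derive; [exact I|ring]. }
      evar_last.
      + apply (is_derive_mult (K := R_AbsRing) sin (fun x => cos x * (cos x ^ 2) ^ n)).
        * apply is_derive_Reals, derivable_pt_lim_sin.
        * apply (is_derive_mult (K := R_AbsRing) cos (fun x => (cos x ^ 2) ^ n)).
          -- apply is_derive_Reals, derivable_pt_lim_cos.
          -- exact D.
          -- intros; apply Rmult_comm.
        * intros; apply Rmult_comm.
      + unfold plus, mult; simpl.
        assert (S := sin2_cos2 x); unfold Rsqr in S.
        assert (P : INR n * (cos x * (cos x * 1)) ^ n = INR n * (cos x * cos x * (cos x * (cos x * 1)) ^ pred n)).
        { destruct n as [|n]; [simpl; ring|simpl; ring]. }
        set (Q := (cos x * (cos x * 1)) ^ n) in *. set (Q' := (cos x * (cos x * 1)) ^ pred n) in *.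
        replace (sin x * (- sin x * Q + cos x * (INR n * (-2 * sin x * cos x) * Q')))
          with (- (sin x * sin x) * Q - 2 * (sin x * sin x) * (INR n * (cos x * cos x * Q'))) by ring.
        replace (cos x * (cos x * Q) + _) with
          (cos x * cos x * Q - (sin x * sin x) * Q - 2 * (sin x * sin x) * (INR n * (cos x * cos x * Q'))) by ring.
        rewrite <- P. replace (sin x * sin x) with (1 - cos x * cos x) by lra. ring.
    - intros x _. apply (continuous_plus (V := R_NormedModule)
        (fun x => (2 * INR n + 2) * (cos x ^ 2) ^ S n) (fun x => - (2 * INR n + 1) * (cos x ^ 2) ^ n));
      (apply continuous_Rmult; [apply continuous_const|apply C]). }
  apply (is_RInt_unique (V := R_CompleteNormedModule)) in H. rewrite cos_neg, cos_PI2 in H.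
  rewrite (RInt_lin (fun x => (cos x ^ 2) ^ S n) (fun x => (cos x ^ 2) ^ n)) in H by auto.
  unfold minus, plus, opp in H; simpl in H. simpl. lra.
Qed.

(** Period [PI] leaves only even frequencies. The index runs over all integers so that the
    three-term recursion has the same form at [0]. *)
Definition cos_moment (y : R -> R) (k : Z) : R :=
  RInt (fun x => y x * cos (IZR k * (2 * x))) (- (PI / 2)) (PI / 2).

Lemma continuous_cos2 (k : Z) (x : R) : continuous (fun x => cos (IZR k * (2 * x))) x.
Proof. apply (ex_derive_continuous (V := R_NormedModule)); auto_derive; exact I. Qed.

Lemma continuous_sin2 (k : Z) (x : R) : continuous (fun x => sin (IZR k * (2 * x))) x.
Proof. apply (ex_derive_continuous (V := R_NormedModule)); auto_derive; exact I. Qed.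

(* The kernels [cos^{2n}] are trigonometric polynomials concentrating at [0]. *)
Lemma cos_moments_zero_le (y : R -> R) : (forall x, continuous y x) ->
  (forall k, cos_moment y k = 0) -> y 0 <= 0.
Proof.
  intros Hc H0; destruct (Rle_dec (y 0) 0) as [|Hy]; [assumption|exfalso].
  assert (Hpi := PI_RGT_0).
  set (K := fun x => cos x ^ 2).
  set (I := fun f : R -> R => RInt f (- (PI / 2)) (PI / 2)).
  assert (CK : forall n x, continuous (fun x => K x ^ n) x).
  { intros n x; apply (ex_derive_continuous (V := R_NormedModule)); unfold K; auto_derive; exact Logic.I. }
  assert (CF : forall n k x, continuous (fun x => y x * K x ^ n * cos (IZR k * (2 * x))) x).
  { intros n k x; repeat apply continuous_Rmult; auto using continuous_cos2. }
  (* Since [cos^2 x = (1 + cos 2x) / 2], one more factor of [K] only mixes the moments [k - 1], [k],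
     [k + 1], so all of them remain zero. *)
  assert (V : forall n k, I (fun x => y x * K x ^ n * cos (IZR k * (2 * x))) = 0).
  { induction n as [|n IH]; intros k.
    - rewrite <- (H0 k); unfold I, cos_moment; apply RInt_ext; intros; simpl; ring.
    - unfold I in *.
      rewrite (RInt_ext _ (fun x => / 2 * (y x * K x ^ n * cos (IZR k * (2 * x)))
        + / 4 * (1 * (y x * K x ^ n * cos (IZR (k + 1) * (2 * x)))
               + 1 * (y x * K x ^ n * cos (IZR (k - 1) * (2 * x)))))).
      + rewrite (RInt_lin (fun x => y x * K x ^ n * cos (IZR k * (2 * x)))
          (fun x => 1 * (y x * K x ^ n * cos (IZR (k + 1) * (2 * x)))
               + 1 * (y x * K x ^ n * cos (IZR (k - 1) * (2 * x))))); auto.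
        2:{ intros x; apply (continuous_plus (V := R_NormedModule)
              (fun x => 1 * (y x * K x ^ n * cos (IZR (k + 1) * (2 * x)))));
            apply continuous_Rmult; auto; apply continuous_const. }
        rewrite (RInt_lin (fun x => y x * K x ^ n * cos (IZR (k + 1) * (2 * x)))
           (fun x => y x * K x ^ n * cos (IZR (k - 1) * (2 * x)))); auto.
        rewrite !IH; Req; ring.
      + intros x _. replace (IZR (k + 1) * (2 * x)) with (IZR k * (2 * x) + 2 * x) by (rewrite plus_IZR; ring).
      replace (IZR (k - 1) * (2 * x)) with (IZR k * (2 * x) - 2 * x) by (rewrite minus_IZR; ring).
        rewrite cos_plus, cos_minus. rewrite (cos_2a_cos x). unfold K; simpl.
        Req. field. }
  destruct (continuous_bounded y (- (PI / 2)) (PI / 2) ltac:(lra) Hc) as [M HM].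
  set (c := y 0 / 2).
  assert (M0 : 0 <= M).
  { apply Rle_trans with (2 := HM 0 ltac:(lra)), Rabs_pos. }
  destruct (Hc 0 (fun v => c < v)) as [d Hd].
  { apply open_gt; unfold c; lra. }
  assert (Hd0 := cond_pos d).
  set (e := Rmin (d / 2) (PI / 2)).
  assert (He : 0 < e) by (apply Rmin_glb_lt; lra).
  assert (He1 : e <= d / 2) by apply Rmin_l. assert (He2 : e <= PI / 2) by apply Rmin_r.
  assert (Se : 0 < sin e) by (apply sin_gt_0; lra).
  (* Chosen so that [y >= c - L sin^2]: near [0] because [y > c], elsewhere because
     [L sin^2 >= c + M] and [y >= - M]. *)
  set (L := (c + M) / sin e ^ 2).
  assert (Se2 : 0 < sin e ^ 2) by now apply pow_lt.
  assert (HL : 0 <= L) by (apply Rdiv_le_0_compat; unfold c; lra).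
  assert (LB : forall x, - (PI / 2) < x < PI / 2 -> c - L * (1 - K x) <= y x).
  { intros x Hx.
    assert (K1 : 1 - K x = sin x ^ 2).
    { unfold K; assert (S := sin2_cos2 x); unfold Rsqr in S; simpl; lra. }
    rewrite K1. assert (S2 := pow2_ge_0 (sin x)).
    destruct (Rlt_dec (Rabs x) e) as [Hlt|Hge].
    - assert (c < y x).
      { apply Hd. change (Rabs (x - 0) < d). rewrite Rminus_0_r; lra. }
      assert (0 <= L * sin x ^ 2) by now apply Rmult_le_pos. lra.
    - assert (S3 : sin e ^ 2 <= sin x ^ 2).
      { assert (G : sin e <= sin (Rabs x)).
        { assert (A := Rabs_pos x); assert (A' : Rabs x <= PI / 2) by (apply Rabs_le; lra).
          apply sin_incr_1; lra. }
        assert (G2 : sin x ^ 2 = sin (Rabs x) ^ 2).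
        { unfold Rabs; destruct (Rcase_abs x); [rewrite sin_neg; ring|reflexivity]. }
        rewrite G2; apply pow_incr; lra. }
      apply Rmult_le_compat_l with (r := L) in S3; [|assumption].
      assert (S4 : L * sin e ^ 2 = c + M) by (unfold L; field; lra).
      specialize (HM x ltac:(lra)). apply Rabs_le_between in HM. lra. }
  set (J := fun n => I (fun x => K x ^ n)).
  assert (JP : forall n, 0 < J n).
  { intros n; apply RInt_gt_0; [lra| |intros; apply CK].
    intros x Hx; apply pow_lt; unfold K; apply pow_lt, cos_gt_0; lra. }
  assert (JW : forall n, (2 * INR n + 2) * J (S n) = (2 * INR n + 1) * J n)
    by (intros n; apply wallis_recursion).
  (* Integrating the lower bound against [K^n] compares [J n] with [J (S n)], and the Wallis ratio
     turns this into a bound that fails for large [n]. *)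
  assert (B : forall n, c * (2 * INR n + 2) <= L).
  { intros n.
    assert (B : (c - L) * J n + L * J (S n) <= 0).
    { rewrite <- (V n 0%Z). unfold J, I.
      rewrite <- RInt_lin by auto.
      apply RInt_le; [lra| | |].
      - apply ex_RInt_cont; intros x.
        apply (continuous_plus (V := R_NormedModule) (fun x => (c - L) * K x ^ n));
          apply continuous_Rmult; auto; apply continuous_const.
      - now apply ex_RInt_cont.
      - intros x Hx. rewrite Rmult_0_l, cos_0, Rmult_1_r.
        assert (0 <= K x ^ n) by (apply pow_le, pow2_ge_0).
        specialize (LB x Hx). apply Rmult_le_compat_r with (r := K x ^ n) in LB; [|assumption].
        simpl. lra. }
    assert (N0 := pos_INR n). specialize (JW n); specialize (JP n).
    apply Rmult_le_compat_r with (r := 2 * INR n + 2) in B; [|lra].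
    apply Rmult_le_reg_r with (J n); [assumption|].
    nra. }
  assert (Hc0 : 0 < c) by (unfold c; lra).
  destruct (nfloor_ex (L / c)) as [n [_ Hn]].
  { now apply Rdiv_le_0_compat. }
  specialize (B n). assert (N0 := pos_INR n).
  apply Rmult_lt_compat_l with (r := c) in Hn; [|assumption].
  replace (c * (L / c)) with L in Hn by (field; lra). nra.
Qed.

(** Translation moves evaluation at [x0] to [0]. The cosine moments of the translate combine cosine
    and sine moments of [y], and the sine moments vanish because [y] is even. The one-sided bound is
    then applied to [y] and to [- y]. *)
Lemma even_cos_moments_zero (y : R -> R) : (forall x, continuous y x) ->
  (forall x, y (x + PI) = y x) -> (forall x, y (- x) = y x) ->
  (forall k, cos_moment y k = 0) -> forall x, y x = 0.
Proof.
  assert (G : forall y : R -> R, (forall x, continuous y x) ->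
    (forall x, y (x + PI) = y x) -> (forall x, y (- x) = y x) ->
    (forall k, cos_moment y k = 0) -> forall x, y x <= 0).
  { clear y; intros y Hc Hp He H0 x0.
    rewrite <- (Rplus_0_l x0). apply (cos_moments_zero_le (fun t => y (t + x0))).
    - intros x; apply (continuous_comp (fun t => t + x0) y); [|apply Hc].
      apply (continuous_plus (V := R_NormedModule)); [apply continuous_id|apply continuous_const].
    - intros k.
      set (g := fun x => y x * cos (IZR k * (2 * (x - x0)))).
      assert (Cg : forall x, continuous g x).
      { intros x; apply continuous_Rmult; [apply Hc|].
        apply (ex_derive_continuous (V := R_NormedModule)); auto_derive; exact I. }
      assert (E1 : cos_moment (fun t => y (t + x0)) k = RInt g (- (PI / 2) + x0) (PI / 2 + x0)).
      { assert (L := RInt_comp_lin (V := R_CompleteNormedModule) g 1 x0 (- (PI / 2)) (PI / 2)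
          (ex_RInt_cont g _ _ Cg)).
        rewrite !Rmult_1_l in L; rewrite <- L. apply RInt_ext; intros x _.
        unfold g; rewrite (Rmult_1_l x). replace (x + x0 - x0) with x by ring.
        symmetry; exact (Rmult_1_l _). }
      rewrite E1. replace (PI / 2 + x0) with (- (PI / 2) + x0 + PI) by field.
      rewrite (RInt_period g _ (- (PI / 2)) Cg).
      2:{ intros x; unfold g; rewrite Hp; f_equal.
        replace (IZR k * (2 * (x + PI - x0))) with (IZR k * (2 * (x - x0)) + 2 * IZR k * PI) by ring.
        rewrite cos_plus. replace (2 * IZR k) with (IZR (2 * k)) by (now rewrite mult_IZR).
        rewrite sin_IZR_PI.
        replace (IZR (2 * k) * PI) with (2 * (IZR k * PI)) by (rewrite mult_IZR; ring).
        rewrite cos_2a_sin, sin_IZR_PI; ring. }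
      replace (- (PI / 2) + PI) with (PI / 2) by field.
      unfold g.
      rewrite (RInt_ext _ (fun x => cos (IZR k * (2 * x0)) * (y x * cos (IZR k * (2 * x)))
         + sin (IZR k * (2 * x0)) * (y x * sin (IZR k * (2 * x))))).
      2:{ intros x _. replace (IZR k * (2 * (x - x0))) with (IZR k * (2 * x) - IZR k * (2 * x0)) by ring.
        rewrite cos_minus. Req. ring. }
      rewrite RInt_lin by (intros; apply continuous_Rmult; auto using continuous_cos2, continuous_sin2).
      fold (cos_moment y k). rewrite H0.
      rewrite (RInt_odd (fun x => y x * sin (IZR k * (2 * x)))); [ring| |].
      + intros; apply continuous_Rmult; auto using continuous_sin2.
      + intros x; rewrite He. replace (IZR k * (2 * - x)) with (- (IZR k * (2 * x))) by ring.
        rewrite sin_neg; ring. }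
  intros Hc Hp He H0 x. apply Rle_antisym; [now apply G|].
  assert (- y x <= 0); [|lra].
  apply (G (fun x => - y x)).
  - intros t; apply (continuous_opp (V := R_NormedModule)), Hc.
  - intros t; now rewrite Hp.
  - intros t; now rewrite He.
  - intros k; unfold cos_moment.
    rewrite (RInt_ext _ (fun x => (-1) * (y x * cos (IZR k * (2 * x))) + 0 * (y x * cos (IZR k * (2 * x))))).
    + rewrite RInt_lin by (intros; apply continuous_Rmult; auto using continuous_cos2).
      fold (cos_moment y k); rewrite H0; ring.
    + intros t _. Req. ring.
Qed.

(** * Moments of Mathieu eigenfunctions *)

Lemma mathieu_sol_continuous (a q : R) (y : R -> R) : mathieu_sol a q y -> forall x, continuous y x.
Proof.
  intros [y' [y'' H]] x; apply (ex_derive_continuous (V := R_NormedModule)).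
  exists (y' x); apply H.
Qed.

(** The equation is integrated against [cos 2kx]: two integrations by parts give [4 k^2], and the
    potential [cos 2x] shifts the index by one. *)
Lemma mathieu_moment_rec (a q : R) (y : R -> R) (k : Z) :
  mathieu_sol a q y -> (forall x, y (x + PI) = y x) ->
  (4 * IZR k ^ 2 - a) * cos_moment y k + q * (cos_moment y (k + 1) + cos_moment y (k - 1)) = 0.
Proof.
  intros Hs Hp. assert (Hc := mathieu_sol_continuous a q y Hs).
  destruct Hs as [y' [y'' H]].
  assert (Hp' : forall x, y' (x + PI) = y' x).
  { intros x.
    assert (D1 : is_derive y x (y' (x + PI))).
    { apply (is_derive_ext (fun t => y (t + PI))); [exact Hp|].
      evar_last.
      - apply (is_derive_comp (V := R_NormedModule) y (fun t => t + PI)).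
        + apply H.
        + auto_derive; [exact I|reflexivity].
      - unfold scal; simpl; unfold mult; simpl; ring. }
    destruct (H x) as [D2 _]. apply is_derive_unique in D1; apply is_derive_unique in D2. congruence. }
  assert (C : forall k x, continuous (fun x => y x * cos (IZR k * (2 * x))) x)
    by (intros; apply continuous_Rmult; auto using continuous_cos2).
  (* [G] collects the boundary terms of both integrations by parts. Its sine part vanishes at the
     ends, and the rest agrees there because [y'] has period [PI]. *)
  set (G := fun x => y' x * cos (IZR k * (2 * x)) + 2 * IZR k * (y x * sin (IZR k * (2 * x)))).
  set (g := fun x => (4 * IZR k ^ 2 - a) * (y x * cos (IZR k * (2 * x)))
     + q * (1 * (y x * cos (IZR (k + 1) * (2 * x))) + 1 * (y x * cos (IZR (k - 1) * (2 * x))))).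
  assert (Cs : forall x, continuous (fun x => 1 * (y x * cos (IZR (k + 1) * (2 * x)))
      + 1 * (y x * cos (IZR (k - 1) * (2 * x)))) x).
  { intros x; apply (continuous_plus (V := R_NormedModule) (fun x => 1 * (y x * cos (IZR (k + 1) * (2 * x)))));
      apply continuous_Rmult; auto; apply continuous_const. }
  assert (F : is_RInt g (- (PI / 2)) (PI / 2) (minus (G (PI / 2)) (G (- (PI / 2))))).
  { apply (is_RInt_derive (V := R_CompleteNormedModule) G).
    - intros x _. destruct (H x) as [D1 [D2 E]].
      assert (A1 : is_derive (fun x => cos (IZR k * (2 * x))) x (- (2 * IZR k) * sin (IZR k * (2 * x))))
        by (auto_derive; [exact I|ring]).
      assert (A2 : is_derive (fun x => sin (IZR k * (2 * x))) x (2 * IZR k * cos (IZR k * (2 * x))))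
        by (auto_derive; [exact I|ring]).
      evar_last.
      + apply (is_derive_plus (V := R_NormedModule) (fun x => y' x * cos (IZR k * (2 * x)))
          (fun x => 2 * IZR k * (y x * sin (IZR k * (2 * x))))).
        * apply (is_derive_mult (K := R_AbsRing) y' (fun x => cos (IZR k * (2 * x)))); [exact D2|exact A1|].
          intros; apply Rmult_comm.
        * apply (is_derive_scal (fun x => y x * sin (IZR k * (2 * x)))).
          apply (is_derive_mult (K := R_AbsRing) y (fun x => sin (IZR k * (2 * x)))); [exact D1|exact A2|].
          intros; apply Rmult_comm.
      + replace (y'' x) with ((2 * q * cos (2 * x) - a) * y x) by lra.
        unfold plus, mult; simpl; unfold g.
        replace (IZR (k + 1) * (2 * x)) with (IZR k * (2 * x) + 2 * x) by (rewrite plus_IZR; ring).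
        replace (IZR (k - 1) * (2 * x)) with (IZR k * (2 * x) - 2 * x) by (rewrite minus_IZR; ring).
        rewrite cos_plus, cos_minus; simpl. Req; ring.
    - intros x _. apply (continuous_plus (V := R_NormedModule)
        (fun x => (4 * IZR k ^ 2 - a) * (y x * cos (IZR k * (2 * x)))));
      apply continuous_Rmult; auto; apply continuous_const. }
  assert (GB : minus (G (PI / 2)) (G (- (PI / 2))) = 0).
  { unfold G. replace (y' (PI / 2)) with (y' (- (PI / 2))) by (rewrite <- Hp'; f_equal; field).
    replace (IZR k * (2 * (PI / 2))) with (IZR k * PI) by field.
    replace (IZR k * (2 * - (PI / 2))) with (- (IZR k * PI)) by field.
    rewrite cos_neg, sin_neg, sin_IZR_PI. unfold minus, plus, opp; simpl; ring. }
  rewrite GB in F. apply (is_RInt_unique (V := R_CompleteNormedModule)) in F. unfold g in F.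
  rewrite (RInt_lin (fun x => y x * cos (IZR k * (2 * x)))
    (fun x => 1 * (y x * cos (IZR (k + 1) * (2 * x))) + 1 * (y x * cos (IZR (k - 1) * (2 * x))))) in F by auto.
  rewrite (RInt_lin (fun x => y x * cos (IZR (k + 1) * (2 * x)))
    (fun x => y x * cos (IZR (k - 1) * (2 * x)))) in F by auto.
  unfold cos_moment. lra.
Qed.

Lemma cos_moment_opp (y : R -> R) (k : Z) : cos_moment y (- k) = cos_moment y k.
Proof.
  unfold cos_moment; apply RInt_ext; intros x _.
  rewrite opp_IZR, Ropp_mult_distr_l_reverse, cos_neg; reflexivity.
Qed.

(** For [q = - 2 / s] the moment recursion times [s / 2] is the recursion of [jac] with parameter
    [- (s * a / 4)]; symmetry in [k] supplies its first step. *)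
Lemma mathieu_moment_jac (s a : R) (y : R -> R) : 0 < s ->
  mathieu_sol a (- 2 / s) y -> (forall x, y (x + PI) = y x) ->
  forall k, cos_moment y k = cos_moment y 0 * jac s (- (s * a / 4)) (Z.abs_nat k).
Proof.
  intros Hs Hy Hp.
  assert (R : forall k, cos_moment y (k + 1) + cos_moment y (k - 1)
    = 2 * (s * IZR k ^ 2 + - (s * a / 4)) * cos_moment y k).
  { intros k; assert (E := mathieu_moment_rec _ _ _ k Hy Hp).
    apply Rmult_eq_reg_l with (2 / s); [|apply Rgt_not_eq, Rdiv_lt_0_compat; lra].
    replace (2 / s * (2 * (s * IZR k ^ 2 + - (s * a / 4)) * cos_moment y k))
      with ((4 * IZR k ^ 2 - a) * cos_moment y k) by (field; lra).
    replace (- 2 / s) with (- (2 / s)) in E by (field; lra). lra. }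
  assert (N : forall n, cos_moment y (Z.of_nat n) = cos_moment y 0 * jac s (- (s * a / 4)) n).
  { intros n; induction n as [| |n IH1 IH2] using nat_ind2.
    - rewrite jac_0; simpl; ring.
    - assert (E := R 0%Z). change (0 + 1)%Z with 1%Z in E. change (0 - 1)%Z with (- (1))%Z in E.
      rewrite cos_moment_opp in E. rewrite jac_1. change (Z.of_nat 1) with 1%Z. simpl in E. lra.
    - assert (E := R (Z.of_nat (S n))).
      replace (Z.of_nat (S n) + 1)%Z with (Z.of_nat (S (S n))) in E by lia.
      replace (Z.of_nat (S n) - 1)%Z with (Z.of_nat n) in E by lia.
      rewrite <- INR_IZR_INZ, IH1, IH2 in E. rewrite jac_SS.
      transitivity (2 * (s * INR (S n) ^ 2 + - (s * a / 4)) * (cos_moment y 0 * jac s (- (s * a / 4)) (S n))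
        - cos_moment y 0 * jac s (- (s * a / 4)) n); [lra|ring]. }
  intros k. destruct (Z_le_gt_dec 0 k) as [Hk|Hk].
  - rewrite <- N. f_equal; lia.
  - rewrite <- N, <- cos_moment_opp. f_equal; lia.
Qed.

Lemma cos_moment_bounded (y : R -> R) : (forall x, continuous y x) ->
  exists B, forall k, Rabs (cos_moment y k) <= B.
Proof.
  intros Hc. assert (P := PI_RGT_0).
  destruct (continuous_bounded y (- (PI / 2)) (PI / 2) ltac:(lra) Hc) as [M HM].
  exists ((PI / 2 - - (PI / 2)) * M); intros k; unfold cos_moment.
  apply abs_RInt_le_const; [lra| |].
  - apply ex_RInt_cont; intros; apply continuous_Rmult; auto using continuous_cos2.
  - intros x Hx. rewrite Rabs_mult, <- (Rmult_1_r M).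
    apply Rmult_le_compat; try apply Rabs_pos; [now apply HM|].
    apply Rabs_le; apply COS_bound.
Qed.

(** Solves [- (s * a / 4) = jac_mu s]: the eigenvalue at which the moment recursion is critical. *)
Definition a_ground (s : R) : R := - (4 * jac_mu s / s).

(** The recursion propagates a vanishing zeroth moment to all moments, and then the function itself
    vanishes. *)
Lemma mathieu_eigen_moment0 (s a : R) (y : R -> R) : 0 < s ->
  mathieu_even_eigen a (- 2 / s) y -> cos_moment y 0 <> 0.
Proof.
  intros Hs [Hy [He [Hp [x Hx]]]] Z; apply Hx.
  apply even_cos_moments_zero; try assumption.
  - exact (mathieu_sol_continuous _ _ _ Hy).
  - intros k; rewrite (mathieu_moment_jac s a y Hs Hy Hp), Z; ring.
Qed.

Lemma mathieu_eigen_ge (s a : R) (y : R -> R) : 0 < s ->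
  mathieu_even_eigen a (- 2 / s) y -> a_ground s <= a.
Proof.
  intros Hs Hy. assert (H0 := mathieu_eigen_moment0 s a y Hs Hy).
  destruct Hy as [Hy [He [Hp _]]].
  destruct (Rle_dec (a_ground s) a) as [|Hlt]; [assumption|exfalso].
  destruct (cos_moment_bounded y (mathieu_sol_continuous _ _ _ Hy)) as [B HB].
  apply (jac_unbounded s (- (s * a / 4)) (B / Rabs (cos_moment y 0)) Hs).
  - unfold a_ground in Hlt. apply Rnot_le_lt in Hlt.
    apply Rmult_lt_compat_l with (r := s / 4) in Hlt; [|lra].
    replace (s / 4 * - (4 * jac_mu s / s)) with (- jac_mu s) in Hlt by (field; lra). lra.
  - intros n; specialize (HB (Z.of_nat n)).
    rewrite (mathieu_moment_jac s a y Hs Hy Hp), Zabs2Nat.id, Rabs_mult in HB.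
    assert (P := Rabs_pos_lt _ H0).
    apply Rmult_le_reg_l with (1 := P).
    replace (Rabs (cos_moment y 0) * (B / Rabs (cos_moment y 0))) with B by (field; lra). exact HB.
Qed.

(** * The ground state as a Mathieu function *)

Definition ground_fun (s t : R) : R := zsum (fun k => ground s k * cos (IZR k * t)).

(** These are the coefficients of [ground_fun s (2 * x)] and of its first two derivatives in [x],
    with one dominating series for termwise differentiation. *)
Lemma ground_trig_summable (s : R) : 0 < s -> exists B : R, forall k,
  Rabs (ground s k) <= B * (/ 2) ^ Z.abs_nat k /\
  Rabs (2 * IZR k * ground s k) <= B * (/ 2) ^ Z.abs_nat k /\
  Rabs (4 * IZR k ^ 2 * ground s k) <= B * (/ 2) ^ Z.abs_nat k.
Proof.
  intros Hs; destruct (ground_uniform_bound s s Hs) as [B [HB H]]. specialize (H s ltac:(lra)).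
  exists (4 * B); intros k; destruct (H k) as [H1 [H2 _]].
  assert (U := ground_pos s k ltac:(lra)).
  assert (Q := pow2_ge_0 (IZR k)).
  assert (P : 0 <= IZR k ^ 2 * ground s k) by (apply Rmult_le_pos; lra).
  repeat split.
  - rewrite Rabs_pos_eq; lra.
  (* The squares give [2 |k| <= 1 + k^2], which reduces this bound to the other two. *)
  - assert (A1 := pow2_ge_0 (IZR k - 1)). assert (A2 := pow2_ge_0 (IZR k + 1)).
    apply Rabs_le; nra.
  - rewrite Rabs_pos_eq; lra.
Qed.

Lemma Rabs_mult_trig_le (c t : R) : Rabs (c * cos t) <= Rabs c /\ Rabs (c * sin t) <= Rabs c.
Proof.
  rewrite !Rabs_mult.
  assert (Rabs (cos t) <= 1) by (apply Rabs_le; apply COS_bound).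
  assert (Rabs (sin t) <= 1) by (apply Rabs_le; apply SIN_bound).
  assert (P := Rabs_pos c). split; nra.
Qed.

Lemma ex_zsum_ground_trig (s t : R) : 0 < s ->
  ex_zsum (fun k => ground s k * cos (IZR k * t)) /\ ex_zsum (fun k => ground s k * sin (IZR k * t)).
Proof.
  intros Hs; destruct (ground_trig_summable s Hs) as [B H].
  split; (apply (ex_zsum_le _ (fun k => B * (/ 2) ^ Z.abs_nat k));
    [intros k; apply Rle_trans with (2 := proj1 (H k))|apply ex_zsum_scal, ex_zsum_geom]).
  - exact (proj1 (Rabs_mult_trig_le _ _)).
  - exact (proj2 (Rabs_mult_trig_le _ _)).
Qed.

Lemma ground_fun_sol (s : R) : 0 < s ->
  mathieu_sol (a_ground s) (- 2 / s) (fun x => ground_fun s (2 * x)).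
Proof.
  intros Hs; destruct (ground_trig_summable s Hs) as [B H].
  assert (EB : ex_zsum (fun k => B * (/ 2) ^ Z.abs_nat k)) by apply ex_zsum_scal, ex_zsum_geom.
  set (f0 := fun (k : Z) (x : R) => ground s k * cos (IZR k * (2 * x))).
  set (f1 := fun (k : Z) (x : R) => - (2 * IZR k * ground s k) * sin (IZR k * (2 * x))).
  set (f2 := fun (k : Z) (x : R) => - (4 * IZR k ^ 2 * ground s k) * cos (IZR k * (2 * x))).
  assert (B0 : forall k x, Rabs (f0 k x) <= B * (/ 2) ^ Z.abs_nat k).
  { intros k x; apply Rle_trans with (1 := proj1 (Rabs_mult_trig_le _ _)); apply H. }
  assert (B1 : forall k x, Rabs (f1 k x) <= B * (/ 2) ^ Z.abs_nat k).
  { intros k x; apply Rle_trans with (1 := proj2 (Rabs_mult_trig_le _ _)); rewrite Rabs_Ropp; apply H. }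
  assert (B2 : forall k x, Rabs (f2 k x) <= B * (/ 2) ^ Z.abs_nat k).
  { intros k x; apply Rle_trans with (1 := proj1 (Rabs_mult_trig_le _ _)); rewrite Rabs_Ropp; apply H. }
  assert (D0 : forall k x, is_derive (f0 k) x (f1 k x)).
  { intros k x; unfold f0, f1; auto_derive; [exact I|ring]. }
  assert (D1 : forall k x, is_derive (f1 k) x (f2 k x)).
  { intros k x; unfold f1, f2; auto_derive; [exact I|ring]. }
  assert (C1 : forall k x, continuous (f1 k) x).
  { intros k x; apply (ex_derive_continuous (V := R_NormedModule)); eexists; apply D1. }
  assert (C2 : forall k x, continuous (f2 k) x).
  { intros k x; apply continuous_Rmult; [apply continuous_const|apply continuous_cos2]. }
  exists (fun x => zsum (fun k => f1 k x)), (fun x => zsum (fun k => f2 k x)); intros x.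
  split; [exact (zsum_is_derive f0 f1 _ _ x B0 EB B1 EB D0 C1)|].
  split; [exact (zsum_is_derive f1 f2 _ _ x B1 EB B2 EB D1 C2)|].
  assert (E0 : ex_zsum (fun k => f0 k x)) by exact (ex_zsum_dominated f0 _ x B0 EB).
  assert (E2 : ex_zsum (fun k => f2 k x)) by exact (ex_zsum_dominated f2 _ x B2 EB).
  unfold ground_fun. change (zsum (fun k => ground s k * cos (IZR k * (2 * x)))) with (zsum (fun k => f0 k x)).
  (* Multiplication by [cos 2x] averages neighbouring coefficients, and [ground_rec] evaluates the
     average. *)
  assert (Sh : cos (2 * x) * zsum (fun k => f0 k x)
    = zsum (fun k => (s * IZR k ^ 2 + jac_mu s) * ground s k * cos (IZR k * (2 * x)))).
  { set (gp := fun k : Z => ground s (k - 1) * cos (IZR k * (2 * x))).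
    set (gm := fun k : Z => ground s (k + 1) * cos (IZR k * (2 * x))).
    assert (M : forall d k, Rabs (ground s k * cos (IZR (k + d) * (2 * x))) <= B * (/ 2) ^ Z.abs_nat k).
    { intros d k; apply Rle_trans with (1 := proj1 (Rabs_mult_trig_le _ _)); apply H. }
    assert (Ep' : ex_zsum (fun k => gp (k + 1)%Z)).
    { apply (ex_zsum_le _ (fun k => B * (/ 2) ^ Z.abs_nat k)); [|assumption].
      intros k; unfold gp. replace (k + 1 - 1)%Z with k by lia. apply M. }
    assert (Em' : ex_zsum (fun k => gm (k - 1)%Z)).
    { apply (ex_zsum_le _ (fun k => B * (/ 2) ^ Z.abs_nat k)); [|assumption].
      intros k; unfold gm. replace (k - 1 + 1)%Z with k by lia. apply M. }
    assert (Ep : ex_zsum gp).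
    { apply (ex_zsum_ext (fun k => gp (k - 1 + 1)%Z)); [intros; f_equal; lia|].
      now apply (ex_zsum_unshift (fun k => gp (k + 1)%Z)). }
    assert (Em : ex_zsum gm).
    { apply (ex_zsum_ext (fun k => gm (k + 1 - 1)%Z)); [intros; f_equal; lia|].
      now apply (ex_zsum_shift (fun k => gm (k - 1)%Z)). }
    transitivity (/ 2 * (zsum gp + zsum gm)).
    - rewrite <- (zsum_shift gp Ep), <- (zsum_unshift gm Em).
      rewrite <- zsum_plus, <- !zsum_scal by assumption.
      apply zsum_ext; intros k; unfold gp, gm, f0.
      replace (k + 1 - 1)%Z with k by lia. replace (k - 1 + 1)%Z with k by lia.
      replace (IZR (k + 1) * (2 * x)) with (IZR k * (2 * x) + 2 * x) by (rewrite plus_IZR; ring).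
      replace (IZR (k - 1) * (2 * x)) with (IZR k * (2 * x) - 2 * x) by (rewrite minus_IZR; ring).
      rewrite cos_plus, cos_minus. field.
    - rewrite <- zsum_plus, <- zsum_scal by assumption.
      apply zsum_ext; intros k; unfold gp, gm.
      replace (/ 2 * (ground s (k - 1) * cos (IZR k * (2 * x)) + ground s (k + 1) * cos (IZR k * (2 * x))))
        with (/ 2 * (ground s (k + 1) + ground s (k - 1)) * cos (IZR k * (2 * x))) by ring.
      rewrite ground_rec; field. }
  replace (zsum (fun k => f2 k x) + _) with
    (zsum (fun k => f2 k x) + a_ground s * zsum (fun k => f0 k x)
      + 4 / s * (cos (2 * x) * zsum (fun k => f0 k x))) by (field; lra).
  rewrite Sh, <- !zsum_scal.
  assert (ES : ex_zsum (fun k => 4 / s * ((s * IZR k ^ 2 + jac_mu s) * ground s k * cos (IZR k * (2 * x))))).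
  { apply (ex_zsum_ext (fun k => (-1) * f2 k x + 4 / s * jac_mu s * f0 k x)).
    - intros k; unfold f0, f2; field; lra.
    - apply ex_zsum_plus; now apply ex_zsum_scal. }
  rewrite <- zsum_plus by (try assumption; now apply ex_zsum_scal).
  rewrite <- zsum_plus by (try assumption; apply ex_zsum_plus; try assumption; now apply ex_zsum_scal).
  rewrite (zsum_ext _ (fun k => 0 * 0)).
  - rewrite (zsum_scal 0 (fun _ => 0)); ring.
  - intros k; unfold f0, f2, a_ground; field; lra.
Qed.

Lemma ground_fun_0 (s : R) : 0 < s -> 0 < ground_fun s 0.
Proof.
  intros Hs; apply Rlt_le_trans with (ground s 0 * cos (IZR 0 * 0)).
  - rewrite Rmult_0_r, cos_0, Rmult_1_r; apply ground_pos; lra.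
  - apply (zsum_nonneg_ge_term (fun k => ground s k * cos (IZR k * 0))).
    + intros k; rewrite Rmult_0_r, cos_0, Rmult_1_r; apply Rlt_le, ground_pos; lra.
    + now apply ex_zsum_ground_trig.
Qed.

Lemma ground_fun_eigen (s : R) : 0 < s ->
  mathieu_even_eigen (a_ground s) (- 2 / s) (fun x => ground_fun s (2 * x)).
Proof.
  intros Hs; split; [now apply ground_fun_sol|]; split; [|split].
  - intros x; unfold ground_fun; apply zsum_ext; intros k.
    replace (IZR k * (2 * - x)) with (- (IZR k * (2 * x))) by ring. now rewrite cos_neg.
  - intros x; unfold ground_fun; apply zsum_ext; intros k; f_equal.
    replace (IZR k * (2 * (x + PI))) with (IZR k * (2 * x) + 2 * (IZR k * PI)) by ring.
    rewrite cos_plus, cos_2a_sin, sin_2a, sin_IZR_PI; ring.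
  - exists 0; rewrite Rmult_0_r; apply Rgt_not_eq; now apply ground_fun_0.
Qed.

(** The multiple of [ground_fun] that matches the zeroth moment matches every moment, as both
    sequences follow the same recursion. *)
Lemma mathieu_eigen_unique (s : R) (y : R -> R) : 0 < s ->
  mathieu_even_eigen (a_ground s) (- 2 / s) y ->
  exists r, forall x, y x = r * ground_fun s (2 * x).
Proof.
  intros Hs Hy. set (U := fun x => ground_fun s (2 * x)).
  assert (HU := ground_fun_eigen s Hs). fold U in HU.
  assert (U0 := mathieu_eigen_moment0 s _ U Hs HU).
  destruct Hy as [Hy [He [Hp _]]]; destruct HU as [Uy [Ue [Up _]]].
  assert (Cy := mathieu_sol_continuous _ _ _ Hy). assert (CU := mathieu_sol_continuous _ _ _ Uy).
  set (r := cos_moment y 0 / cos_moment U 0).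
  exists r; intros x. change (ground_fun s (2 * x)) with (U x).
  assert (Z : 1 * y x + - r * U x = 0); [|lra].
  apply (even_cos_moments_zero (fun x => 1 * y x + - r * U x)).
  - intros t; apply (continuous_plus (V := R_NormedModule) (fun x => 1 * y x));
      apply continuous_Rmult; auto; apply continuous_const.
  - intros t; now rewrite Hp, Up.
  - intros t; now rewrite He, Ue.
  - intros k.
    assert (L : cos_moment (fun x => 1 * y x + - r * U x) k = 1 * cos_moment y k + - r * cos_moment U k).
    { unfold cos_moment. rewrite <- RInt_lin.
      - apply RInt_ext; intros t _. Req. ring.
      - intros; apply continuous_Rmult; auto using continuous_cos2.
      - intros; apply continuous_Rmult; auto using continuous_cos2. }
    rewrite L, (mathieu_moment_jac s _ y Hs Hy Hp k), (mathieu_moment_jac s _ U Hs Uy Up k).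
    unfold r; field; assumption.
Qed.

Lemma a0_neg (s : R) : 0 < s -> a0 (- 2 / s) = a_ground s.
Proof.
  intros Hs; unfold a0. rewrite (is_glb_Rbar_unique _ (Finite (a_ground s))); [reflexivity|].
  split.
  - intros a [y Hy]; simpl; now apply (mathieu_eigen_ge s a y).
  - intros b Hb; apply Hb. exists (fun x => ground_fun s (2 * x)); now apply ground_fun_eigen.
Qed.

(** Translation by half a period changes the sign of [cos 2x], and period [PI] preserves evenness.
    This links [a_0(2/s)] in the dual formula with the parameter [- 2 / s] of the minimiser. *)
Lemma mathieu_even_eigen_shift (a q : R) (y : R -> R) :
  mathieu_even_eigen a q y -> mathieu_even_eigen a (- q) (fun x => y (x + PI / 2)).
Proof.
  intros [[y' [y'' H]] [He [Hp [x0 Hx0]]]]; split; [|split; [|split]].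
  - exists (fun x => y' (x + PI / 2)), (fun x => y'' (x + PI / 2)); intros x.
    destruct (H (x + PI / 2)) as [D1 [D2 E]].
    assert (S : forall (f : R -> R) (l : R), is_derive f (x + PI / 2) l -> is_derive (fun t => f (t + PI / 2)) x l).
    { intros f l D. evar_last.
      - apply (is_derive_comp (V := R_NormedModule) f (fun t => t + PI / 2)); [exact D|].
        auto_derive; [exact I|reflexivity].
      - unfold scal; simpl; unfold mult; simpl; ring. }
    split; [now apply S|split; [now apply S|]].
    replace (2 * (x + PI / 2)) with (2 * x + PI) in E by field. rewrite neg_cos in E. lra.
  - intros x. rewrite <- (He (x + PI / 2)), <- (Hp (- (x + PI / 2))). f_equal; field.
  - intros x; rewrite <- (Hp (x + PI / 2)); f_equal; ring.
  - exists (x0 - PI / 2); now replace (x0 - PI / 2 + PI / 2) with x0 by ring.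
Qed.

Lemma a0_opp (q : R) : a0 (- q) = a0 q.
Proof.
  unfold a0; f_equal; apply Glb_Rbar_eqset; intros a; split; intros [y Hy].
  - exists (fun x => y (x + PI / 2)). rewrite <- (Ropp_involutive q). now apply mathieu_even_eigen_shift.
  - exists (fun x => y (x + PI / 2)). now apply mathieu_even_eigen_shift.
Qed.

Lemma gfun_jac_mu (E s : R) : 0 < s -> gfun E s = 1 - jac_mu s - s * E.
Proof.
  intros Hs; unfold gfun. rewrite <- a0_opp.
  replace (- (2 / s)) with (- 2 / s) by (field; lra). rewrite a0_neg by assumption.
  unfold a_ground; field; lra.
Qed.

(** * The optimal value and its minimisers *)

(** The scalar [w] carries both the normalisation and the phase. *)
Definition ground_state (s : R) (w : C) (k : Z) : C := Cmult w (RtoC (ground s k)).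

Lemma Re_ground_state (s : R) (w : C) (k : Z) : Re (ground_state s w k) = Re w * ground s k.
Proof. unfold ground_state, Cmult, RtoC, Re, Im; simpl; ring. Qed.

Lemma Im_ground_state (s : R) (w : C) (k : Z) : Im (ground_state s w k) = Im w * ground s k.
Proof. unfold ground_state, Cmult, RtoC, Re, Im; simpl; ring. Qed.

Lemma Cmod_ground_state (s : R) (w : C) (k : Z) :
  Cmod (ground_state s w k) ^ 2 = Cmod w ^ 2 * ground s k ^ 2.
Proof. rewrite !Cmod_sqr, Re_ground_state, Im_ground_state; ring. Qed.

Lemma ground_state_summable (s : R) (w : C) : 0 < s ->
  ex_zsum (fun k => Cmod (ground_state s w k) ^ 2) /\
  ex_zsum (fun k => IZR k ^ 2 * Cmod (ground_state s w k) ^ 2).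
Proof.
  intros Hs; destruct (ground_finite_energy s Hs) as [H1 H2]; split.
  - apply (ex_zsum_ext (fun k => Cmod w ^ 2 * ground s k ^ 2));
      [intros; now rewrite Cmod_ground_state|now apply ex_zsum_scal].
  - apply (ex_zsum_ext (fun k => Cmod w ^ 2 * (IZR k ^ 2 * ground s k ^ 2)));
      [intros; rewrite Cmod_ground_state; ring|now apply ex_zsum_scal].
Qed.

Lemma zsum_Cmod_ground_state (s : R) (w : C) :
  zsum (fun k => Cmod (ground_state s w k) ^ 2) = Cmod w ^ 2 * norm2 (ground s) /\
  zsum (fun k => IZR k ^ 2 * Cmod (ground_state s w k) ^ 2) = Cmod w ^ 2 * kinetic (ground s).
Proof.
  unfold norm2, kinetic; rewrite <- !zsum_scal.
  split; apply zsum_ext; intros k; rewrite Cmod_ground_state; ring.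
Qed.

Lemma cosQ_exp_ext (f g : R -> C) : (forall t, f t = g t) -> cosQ_exp f = cosQ_exp g.
Proof.
  intros H; unfold cosQ_exp; f_equal; apply RInt_ext; intros t _; now rewrite H.
Qed.

(** With [kinetic = E * norm2] the balance identity evaluates to the dual value. *)
Lemma cosQ_exp_ground_state (E s : R) (w : C) : 0 < s -> energy_gap E s = 0 ->
  Cmod w ^ 2 * norm2 (ground s) = 1 ->
  cosQ_exp (fourier_fun (ground_state s w)) = 1 - jac_mu s - s * E.
Proof.
  intros Hs HE Hw. destruct (ground_state_summable s w Hs) as [H1 H2].
  rewrite (cosQ_exp_fourier_fun _ H1 H2).
  assert (R1 : hopping (fun k => Re (ground_state s w k)) = Re w ^ 2 * hopping (ground s)).
  { rewrite <- hopping_scal; unfold hopping; f_equal; apply zsum_ext; intros; now rewrite !Re_ground_state. }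
  assert (R2 : hopping (fun k => Im (ground_state s w k)) = Im w ^ 2 * hopping (ground s)).
  { rewrite <- hopping_scal; unfold hopping; f_equal; apply zsum_ext; intros; now rewrite !Im_ground_state. }
  rewrite R1, R2, <- Rmult_plus_distr_r, <- Cmod_sqr.
  assert (B := ground_balance s Hs). unfold energy_gap in HE.
  replace (hopping (ground s)) with ((1 - jac_mu s) * norm2 (ground s) - s * kinetic (ground s)) by lra.
  replace (kinetic (ground s)) with (E * norm2 (ground s)) by lra.
  transitivity ((1 - jac_mu s - s * E) * (Cmod w ^ 2 * norm2 (ground s))); [ring|].
  rewrite Hw; ring.
Qed.

(** Weak duality: the constraint bounds [s] times the energy by [s * E], and both defects are
    nonnegative. Equality forces both to vanish. Arbitrary coefficients are allowed, so the bound
    covers the even competitors of [kappa] as well as the input states. *)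
Lemma cosQ_exp_lower_bound (E s : R) (c : Z -> C) : 0 < s -> l2_unit c -> energy_le c E ->
  1 - jac_mu s - s * E <= cosQ_exp (fourier_fun c) /\
  (cosQ_exp (fourier_fun c) <= 1 - jac_mu s - s * E -> forall k, c k = ground_state s (c 0%Z) k).
Proof.
  intros Hs [H1 N1] [H2 K2].
  rewrite (cosQ_exp_fourier_fun c H1 H2).
  destruct (zsum_Cmod_sqr c H1 H2) as [EN EK]; rewrite EN in N1; rewrite EK in K2.
  destruct (finite_energy_Re_Im c H1 H2) as [A B].
  destruct (ground_representation s _ Hs A) as [_ RA].
  destruct (ground_representation s _ Hs B) as [_ RB].
  assert (DA := defect_nonneg s _ Hs A); assert (DB := defect_nonneg s _ Hs B).
  set (a := fun k => Re (c k)) in *; set (b := fun k => Im (c k)) in *.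
  apply Rmult_le_compat_l with (r := s) in K2; [|lra].
  assert (T : hopping a + hopping b + s * (kinetic a + kinetic b)
    = 1 - jac_mu s + defect s a + defect s b).
  { transitivity ((1 - jac_mu s) * (norm2 a + norm2 b) + defect s a + defect s b); [lra|].
    rewrite N1; ring. }
  split; [lra|]. intros Hle k.
  assert (Za := defect_zero s a Hs A ltac:(lra) k).
  assert (Zb := defect_zero s b Hs B ltac:(lra) k).
  unfold a in Za; unfold b in Zb.
  rewrite <- Re_ground_state in Za; rewrite <- Im_ground_state in Zb.
  destruct (c k), (ground_state s (c 0%Z) k); simpl in *; congruence.
Qed.

Lemma kappa_min (E s : R) : 0 < s -> energy_gap E s = 0 ->
  kappa E = 1 - jac_mu s - s * E /\ kappa_set E (kappa E) /\
  (forall v, kappa_set E v -> kappa E <= v).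
Proof.
  intros Hs HE.
  assert (LB : forall v, kappa_set E v -> 1 - jac_mu s - s * E <= v).
  { intros v [c [Hc [_ [He ->]]]]; now apply cosQ_exp_lower_bound. }
  assert (N := norm2_ground_ge1 s Hs).
  assert (At : kappa_set E (1 - jac_mu s - s * E)).
  { set (w := RtoC (/ sqrt (norm2 (ground s)))).
    assert (Hw : Cmod w ^ 2 * norm2 (ground s) = 1).
    { unfold w; rewrite Cmod_R, pow2_abs, pow_inv, pow2_sqrt by lra. field; lra. }
    destruct (ground_state_summable s w Hs) as [H1 H2].
    destruct (zsum_Cmod_ground_state s w) as [Z1 Z2].
    exists (ground_state s w); split; [|split; [|split]].
    - split; [assumption|]. now rewrite Z1.
    - intros k; unfold ground_state; now rewrite ground_opp.
    - split; [assumption|]. rewrite Z2. unfold energy_gap in HE.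
      replace (kinetic (ground s)) with (E * norm2 (ground s)) by lra.
      replace (Cmod w ^ 2 * (E * norm2 (ground s))) with (E * (Cmod w ^ 2 * norm2 (ground s))) by ring.
      rewrite Hw; lra.
    - symmetry; now apply cosQ_exp_ground_state. }
  assert (K : kappa E = 1 - jac_mu s - s * E).
  { unfold kappa. rewrite (is_glb_Rbar_unique _ (Finite (1 - jac_mu s - s * E))); [reflexivity|].
    split; [intros v Hv; now apply LB|]. intros b Hb; now apply Hb. }
  rewrite K; auto.
Qed.

(** The defect at [s'] of the ground state at [s] equals [gfun E s - gfun E s'] times [norm2]; it is
    nonnegative, and zero only if [s' = s]. *)
Lemma gfun_argmax (E s : R) : 0 < s -> energy_gap E s = 0 ->
  forall s', 0 < s' -> gfun E s' <= gfun E s /\ (gfun E s' = gfun E s -> s' = s).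
Proof.
  intros Hs HE s' Hs'. rewrite !gfun_jac_mu by assumption.
  assert (S := jac_mu_supergradient s s' Hs Hs').
  assert (D := defect_nonneg s' (ground s) Hs' (ground_finite_energy s Hs)).
  assert (N := norm2_ground_ge1 s Hs).
  unfold energy_gap in HE.
  replace (kinetic (ground s)) with (E * norm2 (ground s)) in S by lra.
  assert (T : defect s' (ground s)
    = ((1 - jac_mu s - s * E) - (1 - jac_mu s' - s' * E)) * norm2 (ground s)) by lra.
  split.
  - apply Rminus_le_0, Rmult_le_reg_r with (norm2 (ground s)); lra.
  - intros Heq; symmetry; apply defect_ground_inj; try assumption.
    rewrite T, Heq; lra.
Qed.

Lemma l2_unit_opp (phi : Z -> C) : l2_unit phi -> l2_unit (fun k => phi (- k)%Z).
Proof.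
  intros [H1 H2]; split.
  - exact (ex_zsum_opp _ H1).
  - rewrite <- H2; exact (zsum_opp _ H1).
Qed.

Lemma energy_le_opp (phi : Z -> C) (E : R) : energy_le phi E -> energy_le (fun k => phi (- k)%Z) E.
Proof.
  intros [H1 H2].
  assert (X : forall k : Z, IZR (- k) ^ 2 * Cmod (phi (- k)%Z) ^ 2 = IZR k ^ 2 * Cmod (phi (- k)%Z) ^ 2)
    by (intros; rewrite opp_IZR; ring).
  split.
  - apply (ex_zsum_ext _ _ X). exact (ex_zsum_opp _ H1).
  - rewrite <- (zsum_ext _ _ X). rewrite <- (zsum_opp _ H1) in H2. exact H2.
Qed.

Lemma fourier_fun_ground_state (s : R) (w : C) (t : R) : 0 < s ->
  fourier_fun (ground_state s w) t = Cmult w (RtoC (ground_fun s t)).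
Proof.
  intros Hs; destruct (ex_zsum_ground_trig s t Hs) as [E1 E2].
  apply fourier_fun_real_even; try assumption. intros; apply ground_opp.
Qed.

Theorem theorem8 (E : R) (HE : 0 < E) :
  exists sE : R,
    (* sE is the (unique) argmax over s > 0 of s a_0(2/s)/4 + 1 - s E *)
    (0 < sE /\ forall s, 0 < s -> gfun E s <= gfun E sE /\ (gfun E s = gfun E sE -> s = sE)) /\
    (* kappa(E) is a minimum (attained) *)
    kappa_set E (kappa E) /\ (forall v, kappa_set E v -> kappa E <= v) /\
    (* kappa(E) = max_{s>0} (...) *)
    kappa E = gfun E sE /\
    (* characterization of optimal inputs for the covariant measurement M_{|I><I|} *)
    (forall phi : Z -> C, l2_unit phi -> energy_le phi E ->
       (cosQ_exp (Finv phi) = kappa E <->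
        exists (z : C) (y : R -> R),
          mathieu_even_eigen (a0 (- 2 / sE)) (- 2 / sE) y /\
          forall theta, Finv phi theta = Cmult z (RtoC (y (theta / 2))))).
Proof.
  destruct (energy_gap_root E HE) as [s [Hs Hgap]].
  destruct (kappa_min E s Hs Hgap) as [K [K1 K2]].
  exists s; split; [split; [assumption|now apply gfun_argmax]|].
  split; [assumption|]; split; [assumption|].
  split; [now rewrite gfun_jac_mu|].
  intros phi Hphi Hen. rewrite K, a0_neg by assumption.
  (* [Finv] sums against [exp (- i k t)]; reflecting the index turns it into [fourier_fun] and
     preserves norm and energy. *)
  set (c := fun k => phi (- k)%Z).
  assert (Hc : l2_unit c) by now apply l2_unit_opp.
  assert (Ec : energy_le c E) by now apply energy_le_opp.
  assert (F : forall t, Finv phi t = fourier_fun c t).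
  { intros t; apply Finv_fourier_fun, ex_zsum_Cmod; [apply Hphi|apply Hen]. }
  rewrite (cosQ_exp_ext _ _ F).
  split.
  - intros Heq.
    assert (G := proj2 (cosQ_exp_lower_bound E s c Hs Hc Ec) (Req_le _ _ Heq)).
    exists (c 0%Z), (fun x => ground_fun s (2 * x)); split; [now apply ground_fun_eigen|].
    intros t. replace (2 * (t / 2)) with t by field.
    rewrite F, <- fourier_fun_ground_state by assumption.
    unfold fourier_fun, zsumC. f_equal; apply zsum_ext; intros k; now rewrite (G k) at 1.
  - intros [z [y [Hy Hz]]].
    (* The function is a multiple of [ground_fun], so injectivity of the Fourier series identifies
       [c] with a ground state. The unit norm of [phi] then fixes [|w|], which determines the
       value. *)
    destruct (mathieu_eigen_unique s y Hs Hy) as [r Hr].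
    set (w := Cmult z (RtoC r)).
    destruct (ground_state_summable s w Hs) as [S1 S2].
    assert (G : forall k, c k = ground_state s w k).
    { apply fourier_fun_inj.
      - apply ex_zsum_Cmod; [apply Hc|apply Ec].
      - now apply ex_zsum_Cmod.
      - intros t. rewrite fourier_fun_ground_state, <- F, Hz, Hr by assumption.
        replace (2 * (t / 2)) with t by field.
        unfold w; rewrite RtoC_mult; ring. }
    rewrite (cosQ_exp_ext _ (fourier_fun (ground_state s w))).
    + apply cosQ_exp_ground_state; try assumption.
      rewrite <- (proj1 (zsum_Cmod_ground_state s w)).
      rewrite <- (proj2 Hc). apply zsum_ext; intros k; now rewrite G.
    + intros t; unfold fourier_fun, zsumC. f_equal; apply zsum_ext; intros k; now rewrite (G k).
Qed.
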